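(* For all $n\geq 1$ and $0\le k\le n-1$, $$Q_{n,k}(x,t)=\sum_{F\in \mathcal H_{n,k}}x^{\mathrm{tree}(F)-1}\,t^{\mathrm{bdeg}(F)},$$ equivalently, $$Q_n(x,y,1,t)=\sum_{F\in\mathcal H_n}x^{\mathrm{tree}(F)-1}\,y^{\mathrm{imp}(F)}\,t^{\mathrm{bdeg}(F)}.$$
   Context: Define polynomials $Q_n(x,y,z,t)$ by $Q_1=1$ and $Q_{n+1}=[x+nz+(y+t)(n+y\partial_y)]Q_n$ for $n\ge1$, and define $Q_{n,k}(x,t)$ by $Q_n(x,y,1,t)=\sum_{k=0}^{n-1}Q_{n,k}(x,t)y^k$. A half-mobile tree on a set $S$ is a rooted tree with two kinds of vertices, labeled (white) and unlabeled (black), such that the white vertices are in bijection with $S$; each black vertex has at least two children, all of them white; there is a fixed cyclic order on the children of each black vertex; the children of white vertices are unordered. For a vertex $v$, $\beta_T(v)$ is the smallest white descendant of $v$ (the path from the root to a descendant of $v$ passes through $v$; $v$ is its own descendant). The children of a black vertex are listed in the linear order compatible with its cyclic order whose last (rightmost) element is the child with smallest $\beta_T$. An edge $e=(u,v)$ ($v$ a child of $u$) is improper if either $u,v$ are both white and $u>\beta_T(v)$, or $u$ is black, $v$ is its rightmost child, and $u$ has a (white) parent whose label is greater than $\beta_T(v)$. A forest of half-mobile trees on $[n]$ is a graph whose connected components are half-mobile trees and whose set of white vertices is $[n]$; $\mathcal H_n$ is the set of such forests and $\mathcal H_{n,k}$ those with exactly $k$ improper edges. For $F\in\mathcal H_n$: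 $\mathrm{imp}(F)$ = number of improper edges, $\mathrm{tree}(F)$ = number of component trees, $\mathrm{bdeg}(F)=\sum_v(\deg_F(v)-1)$ over black vertices $v$, with $\deg_F(v)$ the number of children of $v$. *)

(* Defs.v *)
From HB Require Import structures.
From mathcomp Require Import all_boot all_order all_algebra all_fingroup.
From mathcomp Require Import mpoly.

Set Implicit Arguments.
Unset Strict Implicit.
Unset Printing Implicit Defensive.

Import GRing.Theory.
Local Open Scope ring_scope.

Definition vx : 'I_4 := inord 0.
Definition vy : 'I_4 := inord 1.
Definition vz : 'I_4 := inord 2.
Definition vt : 'I_4 := inord 3.

Definition Qop (n : nat) (P : {mpoly int[4]}) : {mpoly int[4]} :=
  'X_vx * P + (n%:R * 'X_vz) * P
  + ('X_vy + 'X_vt) * (n%:R * P + 'X_vy * (P ^`M (vy))).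

(* Qaux m = Q_{m+1} *)
Fixpoint Qaux (m : nat) : {mpoly int[4]} :=
  match m with
  | 0 => 1
  | m'.+1 => Qop m'.+1 (Qaux m')
  end.

(* Q n = Q_n for n >= 1 (Q 0 is a junk value, never used) *)
Definition Q (n : nat) : {mpoly int[4]} := Qaux n.-1.

Definition w0 : 'I_3 := inord 0.
Definition w1 : 'I_3 := inord 1.
Definition w2 : 'I_3 := inord 2.

Definition Qz1 (n : nat) : {mpoly int[3]} :=
  Q n \mPo [tuple 'X_w0; 'X_w1; 1; 'X_w2].

(* Forests of half-mobile trees on [n].                                 *)
(* White vertex with label i+1 is encoded by i : 'I_n (order preserving).*)
(* A forest is encoded by a pair (s, par) where                         *)
(*  - s : {perm 'I_n}: the non-trivial cycles of s are exactly the sets *)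
(*    of children of the black vertices, s giving the cyclic order      *)
(*    (s c = the cyclic successor of c); fixed points of s are the      *)
(*    white vertices whose parent is not black;                         *)
(*  - par : 'I_n -> option 'I_n: if s i = i, par i is the white parent  *)
(*    of i (None if i is a root); if s i <> i, par i is the (white)     *)
(*    parent of the black vertex whose children form the cycle of i     *)
(*    (None if this black vertex is a root).  par is constant on cycles.*)
(* Black vertices are unlabeled, so a black vertex is identified with   *)
(* its (cyclically ordered) set of children; this encoding is a         *)
(* bijection with forests of half-mobile trees on [n].                  *)

Definition forest_code (n : nat) := ({perm 'I_n} * {ffun 'I_n -> option 'I_n})%type.

Section Forest.
Variable n : nat.
Implicit Types (F : forest_code n) (i j c : 'I_n).

Definition wup F (o : option 'I_n) : option 'I_n :=
  if o is Some a then F.2 a else None.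

Definition wdesc F i j : bool :=
  [exists k : 'I_n.+1, iter k (wup F) (Some j) == Some i].

Definition valid_forest F : bool :=
  (* par is constant on the cycles of s (one parent per black vertex) *)
  [forall i, F.2 (F.1 i) == F.2 i]
  (* no cycles: every vertex reaches a root *)
  && [forall i, iter n (wup F) (Some i) == None].

Definition has_black_parent F i : bool := F.1 i != i.

Definition cyc_rep F i : bool := [forall j in porbit F.1 i, (i <= j)%N].

Definition beta F i : 'I_n := [arg min_(j < i | wdesc F i j) (j : nat)].

(* number of trees: white roots + black roots *)
Definition ntree F : nat := #|[set i | (F.2 i == None) && cyc_rep F i]|.

(* bdeg: sum over black vertices of (number of children - 1) *)
Definition bdeg F : nat :=
  \sum_(i | cyc_rep F i && has_black_parent F i) (#|porbit F.1 i| - 1).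

Definition rightmost F v : bool :=
  has_black_parent F v && [forall c in porbit F.1 v, (beta F v <= beta F c)%N].

(* the edge from the parent of the white vertex v to v is improper *)
Definition improper F v : bool :=
  if F.2 v is Some u then
    if has_black_parent F v then
      rightmost F v && (beta F v < u)%N
    else (* white parent u *) (beta F v < u)%N
  else false.

Definition imp F : nat := #|[set v | improper F v]|.

End Forest.

Definition forest_gf (n : nat) : {mpoly int[3]} :=
  \sum_(F : forest_code n | valid_forest F)
     'X_w0 ^+ (ntree F).-1 * 'X_w1 ^+ imp F * 'X_w2 ^+ bdeg F.

(* Main.v *)
Require Import Defs.
From HB Require Import structures.
From mathcomp Require Import all_boot all_order all_algebra all_fingroup.
From mathcomp Require Import mpoly.
From mathcomp Require Import zify ring.

(* Both sides satisfy the same recurrence in n: with k = imp(F), a forest F on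
   [n] must give rise to forests on [n+1] of total weight
   (x + n + (y+t)(n+k)) times that of F.  The largest vertex m = n+1 is either
   - isolated (weight x), or a leaf child of a white vertex (n choices, weight
     1), or a leaf inserted just after a white vertex i in its cycle, a new
     2-cycle if i has no black parent (n choices, weight t);
   - or it takes the place of some white vertex u, which becomes its child,
     alone (n choices, weight y) or together with an initial segment, in order
     of beta, of the improper child edges of u.  This segment is given by its
     last edge, that is, by a marked improper edge of F (k choices).  Then
     either u is a new white child of m (weight y), or u is inserted in the
     cycle of the marked edge, after the rightmost child (weight t).
   In the second case u is recovered from the child v of m that ends the last
   edge in order of beta: it is the cyclic successor of v. *)

Set Implicit Arguments.
Unset Strict Implicit.
Unset Printing Implicit Defensive.

Import GRing.Theory GroupScope.

(** * Cycles of a permutation *)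

Lemma mem_porbit1 (T : finType) (s : {perm T}) x : s x \in porbit s x.
Proof. by have := mem_porbit s 1 x; rewrite expg1. Qed.

Lemma porbit_fix (T : finType) (s : {perm T}) x y :
  s x = x -> y \in porbit s x -> y = x.
Proof. by move=> sx /porbitP[k ->]; rewrite permX; elim: k => //= k ->. Qed.

Section Porbit.
Variables (T U : finType).
Implicit Types (s : {perm T}) (l : T -> T).

Lemma porbit_color (c : T -> U) s :
  (forall x, c (s x) = c x) -> forall x y, y \in porbit s x -> c y = c x.
Proof.
move=> cs x y /porbitP[k ->]; rewrite permX.
by elim: k => //= k; rewrite cs.
Qed.

(** It suffices that [f] keeps each step of [s] within one cycle of [s'], without commuting with the
    permutations. This covers insertion, removal and relabelling of points. *)
Lemma porbit_map (f : T -> U) s (s' : {perm U}) :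
  (forall x, f (s x) \in porbit s' (f x)) ->
  forall x y, y \in porbit s x -> f y \in porbit s' (f x).
Proof.
move=> fs x y /porbitP[k ->]; rewrite permX.
elim: k => [|k IH] /=; first exact: porbit_id.
move: IH (fs (iter k s x)); rewrite -!eq_porbit_mem => /eqP <-.
by [].
Qed.
End Porbit.

(** * Representatives of cycles, and how they follow changes of the cycles *)

Section Choice.
Variable T : finType.
Implicit Types (s : {perm T}) (l : T -> T).

(** The representative is a function constant on cycles, hence idempotent; its fixed points form a
    transversal of the cycles. *)
Definition orbit_choice s l :=
  (forall x, l (s x) = l x) /\ (forall x, l x \in porbit s x).

Lemma orbit_choice_porbit s l : orbit_choice s l ->
  forall x y, y \in porbit s x -> l y = l x.
Proof. by case=> ls _ x y; apply: porbit_color. Qed.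

Lemma orbit_choice_idem s l : orbit_choice s l -> forall x, l (l x) = l x.
Proof. by move=> lP x; apply: (orbit_choice_porbit lP); case: lP. Qed.

Lemma orbit_choice_min s (f : T -> nat) :
  {l | orbit_choice s l & forall x y, y \in porbit s x -> f (l x) <= f y}.
Proof.
pose l x := if [pick y in porbit s x | [forall z in porbit s x, f y <= f z]]
  is Some y then y else x.
have lP x : l x \in porbit s x /\ forall y, y \in porbit s x -> f (l x) <= f y.
  rewrite /l; case: pickP => [y /andP[yx /forall_inP H]|H]; first by split.
  case: (arg_minnP f (porbit_id s x)) => i ix Hi.
  have := H i; rewrite /= (ix : i \in porbit s x) /= => /negbT/negP[].
  by apply/forall_inP.
exists l; last by move=> x; case: (lP x).
split=> [x|x]; last by case: (lP x).
(* The element picked depends only on the cycle as a set, so ties are settled in the same way along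
   a cycle; the default [x] never occurs, since a minimum exists. *)
have E : porbit s (s x) = porbit s x.
  by apply/eqP; rewrite eq_porbit_mem mem_porbit1.
rewrite /l E; case: pickP => // H.
case: (arg_minnP f (porbit_id s x)) => i ix Hi.
have := H i; rewrite /= (ix : i \in porbit s x) /= => /negbT/negP[].
by apply/forall_inP.
Qed.

(** [l2] is injective on the fixed points of [l1], because [l1] recovers such a point from its
    image. Applied both ways, this makes the number of cycles with property [P] independent of the
    choice. *)
Lemma card_orbit_choice s l1 l2 (P : pred T) :
  orbit_choice s l1 -> orbit_choice s l2 -> (forall x, P (s x) = P x) ->
  #|[set x | P x && (l1 x == x)]| <= #|[set x | P x && (l2 x == x)]|.
Proof.
move=> c1 c2 Ps.
have inj : {in [set x | P x && (l1 x == x)] &, injective l2}.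
  move=> x y; rewrite !inE => /andP[_ /eqP Hx] /andP[_ /eqP Hy] E.
  by rewrite -Hx -Hy -(orbit_choice_porbit c1 (c2.2 x)) E
             (orbit_choice_porbit c1 (c2.2 y)).
rewrite -(card_in_imset inj); apply/subset_leq_card/subsetP => z.
case/imsetP=> x; rewrite !inE => /andP[Px _] ->.
by rewrite (orbit_choice_idem c2) eqxx (porbit_color Ps (c2.2 x)) Px.
Qed.

(** The fibres of [l] are the cycles. *)
Lemma sum_orbit_choice s l : orbit_choice s l ->
  \sum_(x | l x == x) #|porbit s x| = #|T|.
Proof.
move=> c; rewrite -sum1_card.
rewrite [RHS](partition_big l (fun x => l x == x)) /=; last first.
  by move=> x _; rewrite (orbit_choice_idem c).
apply: eq_bigr => x /eqP lx; rewrite sum1_card; apply: eq_card => y.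
rewrite [RHS]/in_mem /=; apply/idP/eqP => [/(orbit_choice_porbit c)->//|<-].
by rewrite porbit_sym; case: c.
Qed.

(* Inserts the fixed point [c] of [s] right after [i] in its cycle. *)
Lemma orbit_choice_insert s l i c : orbit_choice s l -> s c = c -> i != c ->
  orbit_choice (tperm i c * s) (fun x => if x == c then l i else l x).
Proof.
move=> lP sc ic; have lc : l c = c by apply: porbit_fix (lP.2 c).
have sE x : s x = c -> x = c by rewrite -{1}sc => /perm_inj.
have li : l i != c.
  apply/eqP=> H; have := lP.2 i; rewrite H porbit_sym => /(porbit_fix sc) E.
  by rewrite E eqxx in ic.
(* Cycles only grow: the step of [s] from [i] becomes two steps, through [c]. *)
have sub : forall x y, y \in porbit s x -> y \in porbit (tperm i c * s) x.
  apply: (@porbit_map _ _ id) => x /=.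
  have [->|xi] := eqVneq x i.
    apply/porbitP; exists 2%N => //.
    by rewrite permX /= !permM tpermL sc tpermR.
  have [->|xc] := eqVneq x c; first by rewrite sc porbit_id.
  apply/porbitP; exists 1%N => //.
  by rewrite expg1 permM tpermD // eq_sym.
split=> x.
  rewrite permM; case: tpermP => [->|->|/eqP xi /eqP xc].
  - by rewrite sc eqxx (negPf ic).
  - by rewrite eqxx; case: eqP => [/sE/eqP|_]; rewrite ?(negPf ic) ?lP.1.
  - by rewrite (negPf xc); case: eqP => [/sE/eqP|_]; rewrite ?(negPf xc) ?lP.1.
case: eqP => [->|_]; last by apply: sub; exact: lP.2.
have := sub _ _ (lP.2 i); rewrite -!eq_porbit_mem => /eqP ->.
rewrite eq_porbit_mem porbit_sym; apply/porbitP; exists 1%N.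
by rewrite expg1 permM tpermL sc.
Qed.

(** The point [c] is short-circuited: its predecessor [i] now goes to [s c]. As [c] does not
    represent its cycle, the old representative survives in what remains. *)
Lemma orbit_choice_remove s l i c : orbit_choice s l -> s i = c -> i != c ->
  l c != c ->
  orbit_choice (tperm i c * s) (fun x => if x == c then c else l x).
Proof.
move=> lP si ic lc.
have sc : s c != c by apply/eqP => H; case/eqP: ic; apply: (@perm_inj _ s); rewrite si H.
have lcx x : l x != c.
  apply: contra lc => /eqP H; rewrite -{1}H.
  by rewrite (orbit_choice_idem lP) H.
set s' := tperm i c * s.
have s'c : s' c = c by rewrite permM tpermR.
(* Projects the old cycle onto the shortened one, merging [c] with its predecessor. *)
pose f x := if x == c then i else x.
have sub : forall x y, y \in porbit s x -> f y \in porbit s' (f x).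
  apply: porbit_map => x; rewrite /f.
  have [->|xc] := eqVneq x c.
    rewrite (negPf sc); apply/porbitP; exists 1%N.
    by rewrite expg1 permM tpermL.
  have [->|xi] := eqVneq x i; first by rewrite si eqxx porbit_id.
  case: eqP => [H|_]; first by case/eqP: xi; apply: (@perm_inj _ s); rewrite si.
  by apply/porbitP; exists 1%N; rewrite expg1 permM tpermD // eq_sym.
split=> x.
  have [->|xc] := eqVneq x c; first by rewrite s'c eqxx.
  case: eqP => [H|_]; first by case/eqP: xc; apply: (@perm_inj _ s'); rewrite s'c.
  rewrite permM; case: tpermP => [->|->|_ _]; rewrite ?lP.1 //.
  1,2: by rewrite -(lP.1 i) si.
case: eqP => [->|/eqP xc]; first exact: porbit_id.
by have := sub _ _ (lP.2 x); rewrite /f (negPf xc) (negPf (lcx x)).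
Qed.

Lemma orbit_choice_conj s l (t : {perm T}) : orbit_choice s l ->
  orbit_choice (s ^ t) (fun x => t (l (t^-1 x))).
Proof.
move=> lP; have sE x : t (s x) = (s ^ t) (t x).
  by rewrite permJ.
split=> x.
  by rewrite -{1}(permKV t x) -sE permK lP.1.
rewrite -{2}(permKV t x).
apply: (@porbit_map _ _ t s) (lP.2 _) => y.
by apply/porbitP; exists 1%N; rewrite expg1 sE.
Qed.
End Choice.

(** * Ancestors, and acyclicity expressed by a rank *)

Section Ancestor.
Variables (N : nat) (F : forest_code N).

(** A rank growing from parent to child is easier to carry through a change of the forest than a
    bound on iterations. *)
Definition ranked := exists r : 'I_N -> nat,
  forall i j, F.2 j = Some i -> r i < r j.

Definition anc (i j : 'I_N) := exists k, iter k (wup F) (Some j) = Some i.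

Lemma iter_wup_None k : iter k (wup F) None = None.
Proof. by elim: k => //= k ->. Qed.

Lemma anc_refl i : anc i i. Proof. by exists 0. Qed.

Lemma anc_parent i j d : F.2 j = Some i -> anc j d -> anc i d.
Proof. by move=> ji [k kd]; exists k.+1; rewrite /= kd. Qed.

Lemma ancP i d : anc i d -> i = d \/ exists2 j, F.2 j = Some i & anc j d.
Proof.
case=> -[[->]|k /=]; first by left.
case E: (iter _ _ _) => [j|] //= ji; right; exists j => //.
by exists k.
Qed.

Lemma anc_comparable i j d : anc i d -> anc j d -> anc i j \/ anc j i.
Proof.
case=> k ki [k' kj]; case: (leqP k k') => H.
  by right; exists (k' - k); rewrite -ki -iterD subnK.
by left; exists (k - k'); rewrite -kj -iterD subnK // ltnW.
Qed.

Lemma rank_iter (r : 'I_N -> nat) k i j :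
  (forall i j, F.2 j = Some i -> r i < r j) ->
  iter k (wup F) (Some j) = Some i -> r i + k <= r j.
Proof.
move=> rP; elim: k i => [|k IH] i /=; first by case=> ->; rewrite addn0.
by case E: (iter _ _ _) => [c|] //= /rP H; have := IH _ E; lia.
Qed.

(** A path of positive length from [j] up to [i] passes first through the common parent, so it would
    also lead from [i] up to [i]. *)
Lemma anc_sibling_eq i j : ranked -> F.2 i = F.2 j -> anc i j -> i = j.
Proof.
case=> r rP ij [[[->//]|k]]; rewrite iterSr /= -ij => H.
have := @rank_iter r k.+1 i i rP; rewrite iterSr /= => /(_ H); lia.
Qed.

Lemma valid_ranked : valid_forest F -> ranked.
Proof.
case/andP=> _ /forallP H.
(* The rank is the depth: the number of white vertices on the path from [i] up to its root. *)
exists (fun i => \sum_(k < N) (iter k (wup F) (Some i) != None)) => i j ji.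
have iS k : iter k.+1 (wup F) (Some j) = iter k (wup F) (Some i).
  by rewrite iterSr /= ji.
suff gen M : iter M (wup F) (Some j) = None ->
    \sum_(k < M) (iter k (wup F) (Some i) != None) <
    \sum_(k < M) (iter k (wup F) (Some j) != None).
  by apply: gen; apply/eqP.
case: M => [//|M] HM.
rewrite [X in _ < X]big_ord_recl /= add1n ltnS big_ord_recr /=.
have -> : iter M (wup F) (Some i) = None by rewrite -iS.
by rewrite addn0; apply: leq_sum => k _; rewrite -iS.
Qed.

(** The converse is a pigeonhole argument: if [N] steps up from [i] did not leave the forest, the
    [N.+1] vertices met would be distinct, because the rank decreases. *)
Lemma valid_forestP :
  reflect ((forall i, F.2 (F.1 i) = F.2 i) /\ ranked) (valid_forest F).
Proof.
apply: (iffP idP) => [v|[Fp [r rP]]].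
  by split; [case/andP: v => /forallP H _ i; apply/eqP | exact: valid_ranked].
apply/andP; split; apply/forallP => i; first by rewrite Fp.
apply: contraT => /eqP H.
have Hk (k : 'I_N.+1) : {c | iter k (wup F) (Some i) = Some c}.
  case E: (iter k _ _) => [c|]; first by exists c.
  case: H; have <- : iter (N - k) (wup F) (iter k (wup F) (Some i)) =
      iter N (wup F) (Some i) by rewrite -iterD subnK // -ltnS.
  by rewrite E iter_wup_None.
have inj : injective (fun k => sval (Hk k)).
  suff lt (k k' : 'I_N.+1) : k < k' -> sval (Hk k) <> sval (Hk k').
    move=> k k' E; apply/val_inj/eqP; case: ltngtP => // /lt; congruence.
  case: (Hk k) (Hk k') => c kc [c' kc'] /= ltk cc; subst c'.
  have := @rank_iter r (k' - k) c c rP.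
  by rewrite -{1}kc -iterD (subnK (ltnW ltk)) => /(_ kc'); lia.
by have := leq_card _ inj; rewrite !card_ord ltnn.
Qed.

Lemma wdescP i j : valid_forest F -> reflect (anc i j) (wdesc F i j).
Proof.
case/andP=> _ /forallP/(_ j)/eqP H.
apply: (iffP existsP) => [[k /eqP]|[k kj]]; first by exists k.
suff kN : k < N.+1 by exists (Ordinal kN); rewrite /= kj.
rewrite ltnNge; apply/negP => Nk.
by move: kj; rewrite -(subnK (ltnW Nk)) iterD H iter_wup_None.
Qed.
End Ancestor.

(* [b] is the statistic beta, and [l] sends a vertex to the child with
   smallest beta in its cycle, so the fixed points of [l] represent the
   cycles.  Both are determined by the forest. *)
Record wf N (F : forest_code N) (b : 'I_N -> nat) (l : 'I_N -> 'I_N) : Prop :=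
  Wf {
    wf_par : forall i, F.2 (F.1 i) = F.2 i;
    wf_rank : ranked F;
    wf_le : forall i, b i <= i;
    wf_mono : forall i j, F.2 j = Some i -> b i <= b j;
    wf_att : forall i, b i = i \/ exists2 j, F.2 j = Some i & b i = b j;
    wf_choice : orbit_choice F.1 l;
    wf_lead : forall i, b (l i) <= b i }.

(** * Beta, representatives and the three statistics derived from the local conditions *)

Section Wf.
Variables (N : nat) (F : forest_code N).

Lemma valid_wf : valid_forest F -> exists b l, wf F b l.
Proof.
move=> v; have [Fp rk] := valid_forestP F v.
have [l lP lb] := orbit_choice_min F.1 (fun i => beta F i).
have bP i : wdesc F i (beta F i) /\
    forall j, wdesc F i j -> beta F i <= j.
  by rewrite /beta; case: arg_minnP => //; apply/wdescP => //; apply: anc_refl.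
exists (fun i => beta F i), l; split=> //.
- move=> i; apply: (bP i).2; apply/wdescP => //; exact: anc_refl.
- move=> i j ji; apply: (bP i).2; apply/wdescP => //.
  by apply: (anc_parent ji); apply/wdescP => //; case: (bP j).
- move=> i; have /wdescP-/(_ v)/ancP[<-|[j ji jd]] := (bP i).1; first by left.
  right; exists j => //; apply/eqP; rewrite eqn_leq; apply/andP; split.
    apply: (bP i).2; apply/wdescP => //; apply: (anc_parent ji).
    by apply/wdescP => //; case: (bP j).
  by apply: (bP j).2; apply/wdescP.
- by move=> i; apply: lb; apply: porbit_id.
Qed.

Variables (b : 'I_N -> nat) (l : 'I_N -> 'I_N).
Hypothesis H : wf F b l.

Lemma wf_valid : valid_forest F.
Proof. by apply/valid_forestP; split; case: H. Qed.

Lemma wf_anc i j : anc F i j -> b i <= b j.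
Proof.
case=> k; elim: k i => [|k IH] i /=; first by case=> ->.
by case E: (iter _ _ _) => [c|] //= /(wf_mono H) ci; apply: leq_trans (IH _ E).
Qed.

(** The walk down the children that attain [b i] ends, because the rank grows at each step and is at
    most [M]; it ends at a vertex whose label is the value. *)
Lemma wf_attained i : exists2 j : 'I_N, anc F i j & b i = j.
Proof.
case: (wf_rank H) => r rP; pose M := \max_i r i.
have rM c : r c <= M by apply: leq_bigmax.
elim: {i}(M - r i).+1 {-2}i (ltnSn (M - r i)) => // k IH i ik.
case: (wf_att H i) => [E|[j ji ->]]; first by exists i => //; apply: anc_refl.
have [|d jd ->] := IH j; first by have := rP _ _ ji; have := rM j; lia.
by exists d => //; apply: anc_parent jd.
Qed.

(** Monotonicity makes [b i] a lower bound for the labels below [i], and one of them attains it. So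
    beta is determined by local conditions, and these are all that an operation on forests must
    preserve. *)
Lemma wf_beta i : beta F i = b i :> nat.
Proof.
have v := wf_valid; rewrite /beta; case: arg_minnP => [|d].
  by apply/wdescP => //; apply: anc_refl.
move=> /(wdescP _ _ v) id dmin; apply/eqP; rewrite eqn_leq; apply/andP; split.
  by have [j ij ->] := wf_attained i; apply: dmin; apply/wdescP.
exact: leq_trans (wf_anc id) (wf_le H _).
Qed.

(** Equal values give a common descendant; its ancestors are comparable, and comparable siblings
    coincide. Hence beta has no ties among siblings. *)
Lemma wf_sibling i j : F.2 i = F.2 j -> b i = b j -> i = j.
Proof.
move=> pij bij; have [d id bi] := wf_attained i.
have [d' jd bj] := wf_attained j.
have dd : d' = d by apply/val_inj; rewrite /= -bi -bj.
rewrite dd in jd.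
have [/anc_sibling_eq->|/anc_sibling_eq->] // := anc_comparable id jd;
  exact: wf_rank H.
Qed.

Lemma wf_par_porbit i j : j \in porbit F.1 i -> F.2 j = F.2 i.
Proof. exact: porbit_color (wf_par H) _ _. Qed.

Lemma wf_par_lead i : F.2 (l i) = F.2 i.
Proof. by apply: wf_par_porbit; apply: (wf_choice H).2. Qed.

Lemma wf_leadE i : [forall c in porbit F.1 i, beta F i <= beta F c] = (l i == i).
Proof.
apply/forall_inP/eqP => [min|li c ci].
  apply: wf_sibling; first exact: wf_par_lead.
  apply/eqP; rewrite eqn_leq (wf_lead H) -!wf_beta; apply: min.
  exact: (wf_choice H).2.
by rewrite !wf_beta -li -(orbit_choice_porbit (wf_choice H) ci) (wf_lead H).
Qed.

Lemma wf_fixed i : F.1 i = i -> l i = i.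
Proof. by move=> Fi; apply: porbit_fix Fi _; apply: (wf_choice H).2. Qed.

(** A vertex without a black parent is alone in its cycle and represents it, so both kinds of
    improper edge take the same form. *)
Lemma wf_improper v :
  improper F v = (l v == v) && (if F.2 v is Some u then b v < u else false).
Proof.
rewrite /improper; case: (F.2 v) => [u|]; last by rewrite andbF.
rewrite wf_beta /rightmost wf_leadE /has_black_parent.
case: eqP => //= /wf_fixed ->.
by rewrite eqxx.
Qed.

Lemma cyc_rep_choice : exists2 q, orbit_choice F.1 q &
  forall i, cyc_rep F i = (q i == i).
Proof.
have [q qP qm] := orbit_choice_min F.1 (@nat_of_ord N).
exists q => // i; apply/forall_inP/eqP => [min|qi j ij].
  apply/val_inj/eqP; rewrite eqn_leq /= qm ?porbit_id // min //; exact: qP.2.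
by rewrite -qi; apply: qm.
Qed.

(** [cyc_rep] marks a cycle at its least label and [l] at its least beta; this lets all statistics
    be read at the fixed points of [l]. *)
Lemma wf_card_rep (P : pred 'I_N) : (forall i, P (F.1 i) = P i) ->
  #|[set i | P i && cyc_rep F i]| = #|[set i | P i && (l i == i)]|.
Proof.
move=> PF; have [q qP qE] := cyc_rep_choice.
under eq_finset => i do rewrite qE.
have lP := wf_choice H.
by apply/eqP; rewrite eqn_leq !(@card_orbit_choice _ F.1).
Qed.

Lemma wf_ntree : ntree F = #|[set i | (F.2 i == None) && (l i == i)]|.
Proof. by rewrite -wf_card_rep // => i; rewrite (wf_par H). Qed.

(** A cycle of size [d] has [d - 1] members other than its representative. *)
Lemma wf_bdeg : bdeg F = #|[set i | l i != i]|.
Proof.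
have [q qP qE] := cyc_rep_choice.
(* Cycles of size one contribute 0, so the sum may run over all cycles. *)
have -> : bdeg F = \sum_(i | q i == i) (#|porbit F.1 i| - 1).
  rewrite /bdeg big_mkcond [RHS]big_mkcond; apply: eq_bigr => i _.
  rewrite qE /has_black_parent; case: eqP => //= _; case: eqP => //= Fi.
  suff -> : porbit F.1 i = [set i] by rewrite cards1.
  apply/setP => j; rewrite inE; apply/idP/eqP => [/(porbit_fix Fi)//|->].
  exact: porbit_id.
apply/eqP; rewrite -(eqn_add2r #|[set i | q i == i]|) -[X in _ + X == _]sum1_card.
rewrite [X in _ + X == _](eq_bigl (fun i => q i == i)); last first.
  by move=> i; rewrite inE.
rewrite -big_split /= (eq_bigr (fun i => #|porbit F.1 i|)); last first.
  by move=> i _; rewrite subnK // lt0n card_porbit_neq0.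
rewrite (sum_orbit_choice qP).
have -> : #|[set i | q i == i]| = #|[set i | l i == i]|.
  have := @wf_card_rep predT (fun _ => erefl) => /=.
  by under eq_finset => i do rewrite qE.
rewrite addnC -cardsT -(cardsID [set i | l i == i] [set: 'I_N]); apply/eqP.
by congr (_ + _); apply: eq_card => i; rewrite !inE ?andbT.
Qed.

Lemma wf_imp : imp F =
  #|[set i | (l i == i) && (if F.2 i is Some u then b i < u else false)]|.
Proof. by apply: eq_card => i; rewrite !inE wf_improper. Qed.

Lemma wf_ntree_gt0 : 0 < N -> 0 < ntree F.
Proof.
move=> N0; case: (wf_rank H) => r rP; rewrite wf_ntree.
(* A vertex of least rank has no parent, so its cycle is the top of a tree. *)
case: (arg_minnP r (isT : predT (Ordinal N0))) => i _ min.
apply/card_gt0P; exists (l i); rewrite inE wf_par_lead.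
rewrite (orbit_choice_idem (wf_choice H)) eqxx andbT.
by case E: (F.2 i) => [u|//]; have := rP _ _ E; have := min u isT; lia.
Qed.

Local Open Scope ring_scope.
Variables (R : comNzRingType) (x y t : R).

(** Spreads the weight over the vertices: a non-representative carries one unit of [bdeg], a
    representative carries the edge or the root above its cycle. A local change of the forest then
    affects few factors. *)
Definition omega i : R :=
  if l i != i then t
  else if F.2 i is Some u then (if (b i < u)%N then y else 1) else x.

Lemma wf_weight : x ^+ ntree F * y ^+ imp F * t ^+ bdeg F = \prod_i omega i.
Proof.
rewrite wf_ntree wf_imp wf_bdeg -!prodr_const !(big_mkcond (fun i => i \in _)).
rewrite -!big_split /=; apply: eq_bigr => i _; rewrite !inE /omega.
case: (l i == i); case: (F.2 i) => [u|] //=; try case: ifP => _;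
  by rewrite ?mul1r ?mulr1.
Qed.
End Wf.

Section WfMore.
Variables (N : nat).
Implicit Types (F : forest_code N) (b : 'I_N -> nat) (l : 'I_N -> 'I_N).

Lemma wf_par_neq F b l i : wf F b l -> F.2 i != Some i.
Proof. by case/wf_rank=> r rP; apply/eqP => /rP; rewrite ltnn. Qed.

Lemma wf_parC F b l i j : wf F b l -> F.2 i = Some j -> F.2 j != Some i.
Proof. by case/wf_rank=> r rP /rP ij; apply/eqP => /rP; lia. Qed.

Lemma wf_leadI F b l i : wf F b l -> l (l i) = l i.
Proof. by move=> H; apply: orbit_choice_idem (wf_choice H) i. Qed.

Lemma wf_unique F b l b' l' : wf F b l -> wf F b' l' -> b =1 b' /\ l =1 l'.
Proof.
move=> H H'; have bb i : b i = b' i by rewrite -(wf_beta H) (wf_beta H').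
split=> // i.
have lmin b1 l1 : wf F b1 l1 -> forall c, c \in porbit F.1 i -> b1 (l1 i) <= b1 c.
  move=> H1 c /(orbit_choice_porbit (wf_choice H1)) <-; exact: wf_lead H1 c.
apply: (wf_sibling H); first by rewrite (wf_par_lead H) (wf_par_lead H').
apply/eqP; rewrite eqn_leq (lmin _ _ H) ?(wf_choice H').2 //.
by rewrite !bb (lmin _ _ H') ?(wf_choice H).2.
Qed.

Lemma wf_leadP F b l i a : wf F b l ->
  [exists c in porbit F.1 i, beta F c < a] = (b (l i) < a).
Proof.
move=> H; apply/exists_inP/idP => [[c ci]|la]; last first.
  by exists (l i); rewrite ?(wf_beta H) ?(wf_choice H).2.
rewrite (wf_beta H) -(orbit_choice_porbit (wf_choice H) ci).
exact: leq_ltn_trans (wf_lead H c).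
Qed.

Lemma wf_perm F b l (s : {perm 'I_N}) l' : wf F b l -> (forall i, F.2 (s i) = F.2 i) ->
  orbit_choice s l' -> (forall i, b (l' i) <= b i) -> wf (s, F.2) b l'.
Proof. by case=> *; split. Qed.
End WfMore.

(** * Operations on the largest vertex [m], isolated at first *)

Section Insertion.
Variable n : nat.
Local Notation N := n.+1.
Local Notation m := (@ord_max n).
Implicit Types (F G : forest_code N) (b : 'I_N -> nat) (l : 'I_N -> 'I_N).
Implicit Types (u v w i j c : 'I_N).

Definition leaf F := [forall i, F.2 i != Some m].
Definition iso F := [&& leaf F, F.1 m == m & F.2 m == None].

Lemma ltn_max i : i != m -> i < m.
Proof. by move=> im; rewrite ltn_neqAle leq_ord andbT; apply: im. Qed.

Lemma leafP F : reflect (forall i, F.2 i <> Some m) (leaf F).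
Proof. by apply: (iffP forallP) => H i; apply/eqP/H. Qed.

Lemma leaf_b F b l : wf F b l -> leaf F -> b m = m.
Proof. by move=> H /leafP L; case: (wf_att H m) => // -[j /L]. Qed.

Definition updm F (o : option 'I_N) : {ffun 'I_N -> option 'I_N} :=
  [ffun w => if w == m then o else F.2 w].

(** A leaf with the largest label has no influence on the beta of other vertices, so [b] and [l]
    stay the same. *)
Lemma wf_updm F b l o : wf F b l -> leaf F -> F.1 m = m -> o != Some m ->
  wf (F.1, updm F o) b l.
Proof.
move=> H L Fm om; have bm := leaf_b H L; move/leafP: L => L.
have Fn i : (F.1 i == m) = (i == m) by rewrite -{1}Fm (inj_eq perm_inj).
split; rewrite /= ; try by case: H.
- by move=> i; rewrite !ffunE Fn (wf_par H).
- case: (wf_rank H) => r rP.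
  exists (fun w => if w == m then (if o is Some i then (r i).+1 else 0) else r w).
  move=> i j /=; rewrite ffunE; case: eqVneq => [_ oi|jm ji].
    by rewrite oi ifN ?ltnS //; apply: contraNneq om => <-; rewrite oi.
  by rewrite ifN ?rP //; apply/eqP => im; rewrite im in ji; case: (L j).
- move=> i j; rewrite ffunE; case: eqVneq => [-> oi|_]; last exact: (wf_mono H).
  by rewrite bm; apply: leq_trans (wf_le H i) (leq_ord _).
- move=> i; case: (wf_att H i) => [->|[j ji bij]]; first by left.
  case: (eqVneq j m) => jm.
    left; apply/eqP; rewrite eqn_leq (wf_le H) bij jm bm; exact: leq_ord.
  by right; exists j; rewrite ?ffunE ?(negPf jm).
Qed.

Definition insert_child F i : forest_code N := (F.1, updm F (Some i)).

Definition insert_cycle F i : forest_code N := (tperm i m * F.1, updm F (F.2 i)).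

(* The vertex m takes the place of u; the children of m are u and the former
   children of u whose cycle has smallest beta less than a. *)
Definition attach_par F u a : {ffun 'I_N -> option 'I_N} :=
  [ffun w => if w == u then Some m else if w == m then F.2 u
     else if (F.2 w == Some u) && [exists c in porbit F.1 w, beta F c < a]
     then Some m else F.2 w].

(** Conjugation exchanges [u] and [m] in the cycles: [m] enters the cycle of [u], and [u] becomes a
    fixed point if [m] was one. *)
Definition attach0 F u a : forest_code N := (F.1 ^ tperm u m, attach_par F u a).

Lemma tperm_conj (s : {perm 'I_N}) u w :
  (s ^ tperm u m) w = tperm u m (s (tperm u m w)).
Proof. by rewrite -{1}(tpermK u m w) permJ. Qed.

Lemma isoP F : reflect [/\ leaf F, F.1 m = m & F.2 m = None] (iso F).
Proof. by apply: (iffP and3P) => -[? /eqP ? /eqP ?]. Qed.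

Definition lconj u l w := tperm u m (l (tperm u m w)).

Lemma lconj_choice s l u : orbit_choice s l ->
  orbit_choice (s ^ tperm u m) (lconj u l).
Proof.
move=> /(@orbit_choice_conj _ _ _ (tperm u m)) [P Q].
by split=> i; [have := P i | have := Q i]; rewrite !tpermV.
Qed.

(** * Substitution of [m] for a white vertex [u] *)

Section Attach.
Variables (F : forest_code N) (b : 'I_N -> nat) (l : 'I_N -> 'I_N).
Variables (u : 'I_N) (a : nat).
Hypotheses (H : wf F b l) (isoF : iso F) (um : u != m) (au : a <= u).

Lemma attach_parE w : attach_par F u a w =
  if w == u then Some m else if w == m then F.2 u
  else if (F.2 w == Some u) && (b (l w) < a) then Some m else F.2 w.
Proof. by rewrite ffunE (wf_leadP _ _ H). Qed.

(** [c] is the new beta of [u]: the minimum of its label and of the betas of the children that it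
    keeps. *)
Lemma attach_rest : exists c : nat, [/\ c <= u,
  forall w, F.2 w = Some u -> a <= b (l w) -> c <= b w &
  c = u \/ exists w, [/\ F.2 w = Some u, a <= b (l w) & c = b w]].
Proof.
pose P w := (w == u) || (F.2 w == Some u) && (a <= b (l w)).
pose f w := if w == u then u : nat else b w.
have Pu : P u by rewrite /P eqxx.
case: (arg_minnP f Pu) => i Pi min; exists (f i); split.
- by have := min u Pu; rewrite {2}/f eqxx.
- move=> w wu aw; have Pw : P w by rewrite /P wu eqxx aw orbT.
  apply: leq_trans (min w Pw) _; rewrite /f; case: eqP => // wE.
  by case/eqP: (wf_par_neq u H); rewrite -{1}wE.
- move: Pi; rewrite /P /f; case: eqP => [|_] /=; first by left.
  by case/andP=> /eqP iu ai; right; exists i.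
Qed.

(** All that was below [u] is now below [m], which inherits its beta; above, the only new descendant
    is [m], the largest label. The bound on [b' u] puts [u] after the cycles given to [m] in the
    order of beta. *)
Lemma wf_attach0 : exists b', [/\ wf (attach0 F u a) b' (lconj u l),
  b' m = b u, (forall w, w != u -> w != m -> b' w = b w) & a <= b' u].
Proof.
have [c [cu cle catt]] := attach_rest.
case/isoP: isoF => /leafP L Fm pm.
have bm : b m = m by apply: leaf_b H _; apply/leafP.
have Fn i : (F.1 i == m) = (i == m) by rewrite -{1}Fm (inj_eq perm_inj).
have lm : l m = m := wf_fixed H Fm.
have ln i : i != m -> l i != m.
  move=> im; apply: contraNneq im => lim.
  by have := (wf_choice H).2 i; rewrite lim porbit_sym => /(porbit_fix Fm) ->.
have puu := wf_par_neq u H.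
have buc : b u <= c.
  case: catt => [->|[w [wu _ ->]]]; [exact: (wf_le H) | exact: (wf_mono H)].
exists (fun w => if w == u then c else if w == m then b u else b w).
have mu : (m == u) = false by rewrite eq_sym (negPf um).
split; rewrite ?eqxx ?mu //; last 2 first.
- by move=> w /negPf-> /negPf->.
- case: catt => [->|[w [wu aw ->]]] //; exact: leq_trans aw (wf_lead H w).
split=> /=.
- move=> w; rewrite tperm_conj.
  case: (tpermP u m w) => [->|->|/eqP wu /eqP wm].
  + by rewrite Fm tpermR.
  + have [->|Fu] := eqVneq (F.1 u) u; first by rewrite tpermL.
    rewrite tpermD 1?eq_sym ?Fn // !attach_parE (negPf Fu) Fn (negPf um).
    by rewrite (wf_par H) (negPf puu) /= mu eqxx.
  + have [Fw|Fw] := eqVneq (F.1 w) u.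
      have pwu : F.2 w = F.2 u by rewrite -Fw (wf_par H).
      by rewrite Fw tpermL !attach_parE mu eqxx (negPf wu) (negPf wm) pwu (negPf puu).
    rewrite tpermD 1?eq_sym ?Fn // !attach_parE (negPf Fw) Fn (negPf wm) (negPf wu).
    by rewrite (wf_par H) (wf_choice H).1.
- case: (wf_rank H) => r rP.
  (* Doubled ranks leave a free value for [u] between [m], in its old place, and the children that
     [u] keeps. *)
  exists (fun w => if w == m then (r u).*2 else if w == u then (r u).*2.+1 else (r w).*2).
  move=> i j /=; rewrite attach_parE.
  have [->|ju] := eqVneq j u; first by case=> <-; rewrite eqxx (negPf um).
  have [_|jm] := eqVneq j m.
    move=> pu; have := rP _ _ pu; case: eqP => [im|_]; first by case: (L u); rewrite pu im.
    case: eqP => [iu|_]; first by rewrite pu iu eqxx in puu.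
    by rewrite ltn_double.
  case: ifP => [/andP[/eqP pj _] [<-]|_ pj].
    by rewrite eqxx ltn_double; apply: rP.
  have := rP _ _ pj; case: eqP => [im|_]; first by case: (L j); rewrite pj im.
  by case: eqP => [->|_]; lia.
- move=> i; case: eqP => [->//|_]; case: eqP => [->|_]; last exact: (wf_le H).
  exact: leq_trans (wf_le H u) (leq_ord _).
- move=> i j; rewrite attach_parE.
  have [_|ju] := eqVneq j u; first by case=> <-; rewrite mu eqxx.
  have [_|jm] := eqVneq j m.
    move=> pu; have := wf_mono H pu.
    case: eqP => [iu|_]; first by rewrite pu iu eqxx in puu.
    by case: eqP => [im|//]; case: (L u); rewrite pu im.
  case: ifP => [/andP[/eqP pj _] [<-]|A pj].
    by rewrite mu eqxx; apply: (wf_mono H).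
  case: eqP => [iu|_].
    rewrite iu in pj; apply: cle => //.
    by move: A; rewrite pj eqxx /=; lia.
  case: eqP => [im|_]; [by case: (L j); rewrite pj im | exact: (wf_mono H)].
- move=> i; have [->|iu] := eqVneq i u.
    case: catt => [|[w [wu aw cw]]]; first by left.
    right; exists w; rewrite ?attach_parE.
      rewrite ifN; last by apply: contraNneq puu => E; rewrite -{1}E wu.
      rewrite ifN; last by apply/eqP => E; move: wu; rewrite E pm.
      by rewrite ltnNge aw andbF.
    rewrite ifN; last by apply: contraNneq puu => E; rewrite -{1}E wu.
    by rewrite ifN //; apply/eqP => E; move: wu; rewrite E pm.
  have [->|im] := eqVneq i m.
    (* The beta of [m] is attained at the child [u] if it is the label of [u]. Otherwise a child [j]
       of [u] attained it: [j] itself serves if it has moved to [m], and [u] serves if it keeps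
       [j]. *)
    right; have := wf_att H u; case=> [bu|[j ju bj]].
      by exists u; rewrite ?attach_parE ?eqxx //; apply/eqP; rewrite eqn_leq buc bu.
    have jnu : j != u by apply: contraNneq puu => E; rewrite -{1}E ju.
    have jm : j != m by apply/eqP => E; move: ju; rewrite E pm.
    have [ja|aj] := ltnP (b (l j)) a.
      exists j; first by rewrite attach_parE (negPf jnu) (negPf jm) ju eqxx ja.
      by rewrite (negPf jnu) (negPf jm).
    exists u; first by rewrite attach_parE eqxx.
    by rewrite eqxx; apply/eqP; rewrite eqn_leq buc bj cle.
  case: (wf_att H i) => [|[j ji bj]]; first by left.
  have jm : j != m by apply/eqP => E; move: ji; rewrite E pm.
  right; have [ju|ju] := eqVneq j u.
    exists m; first by rewrite attach_parE mu eqxx -ju.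
    by rewrite mu eqxx bj ju.
  exists j; last by rewrite (negPf ju) (negPf jm).
  rewrite attach_parE (negPf ju) (negPf jm) ji ifN //.
  by rewrite negb_and; apply/orP; left; apply: contraNneq iu => -[->].
- exact: lconj_choice (wf_choice H).
- move=> w; rewrite /lconj; case: (tpermP u m w) => [->|->|/eqP wu /eqP wm].
  + by rewrite lm tpermR eqxx.
  + case: (tpermP u m (l u)) => [_|lu|/eqP lu /eqP lu']; rewrite ?eqxx ?mu //.
      by have := ln u um; rewrite lu eqxx.
    by rewrite (negPf lu) (negPf lu') (wf_lead H).
  + rewrite (negPf wu) (negPf wm).
    case: (tpermP u m (l w)) => [lw|lw|/eqP lu /eqP lu'].
    * by rewrite eqxx mu -lw (wf_lead H).
    * by have := ln w wm; rewrite lw eqxx.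
    * by rewrite (negPf lu) (negPf lu') (wf_lead H).
Qed.
End Attach.

(* A marker is [inl u] when m takes the place of u and keeps u as its only
   child, and [inr (v, e)] when the child edge of u leading to v or to its black
   parent is marked; [e] says whether u is then inserted in the cycle of v. *)
Definition marker := ('I_N + 'I_N * bool)%type.
Implicit Types z : marker.

Definition target F z := match z with inl u => u | inr (v, _) => odflt v (F.2 v) end.
(** The successor makes the marked edge itself move under the strict comparison of [attach_par]; the
    bound 0 moves no child. *)
Definition bound F z := match z with inl _ => 0 | inr (v, _) => (beta F v).+1 end.
(** Multiplication on the left inserts [u], by then a fixed point, right after [v]. *)
Definition shift F z : {perm 'I_N} :=
  if z is inr (v, true) then tperm v (target F z) else 1.
Definition marker_ok F z :=
  match z with inl u => u != m | inr (v, _) => improper F v end.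

Definition attach F z : forest_code N :=
  (shift F z * F.1 ^ tperm (target F z) m, attach_par F (target F z) (bound F z)).

Definition last_child G b l v :=
  [/\ G.2 v = Some m, l v = v &
      forall w, G.2 w = Some m -> l w = w -> b w <= b v].

(** What the new forest reveals of the marker once [u] is known: whether [m] has other children,
    whether [u] is alone in its cycle, and which other representative below [m] is last. *)
Definition marker_spec G b l u z :=
  match z with
  | inl _ => G.1 u = u /\ forall w, G.2 w = Some m -> w = u
  | inr (v, e) => [/\ (G.1 u == u) = ~~ e, v != u, G.2 v = Some m, l v = v &
      forall w, w != u -> G.2 w = Some m -> l w = w -> b w <= b v]
  end.

(** The inequality between bound and target is the impropriety of the marked edge. *)
Lemma marker_okP F b l z : wf F b l -> iso F -> marker_ok F z ->
  [/\ target F z != m, bound F z <= target F z &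
    if z is inr (v, _) then
      [/\ F.2 v = Some (target F z), l v = v, bound F z = (b v).+1,
          v != target F z & v != m]
    else bound F z = 0].
Proof.
move=> H /isoP[/leafP L Fm pm]; case: z => [u|[v e]] //=.
rewrite (wf_improper H) (wf_beta H) => /andP[/eqP lv].
case E: (F.2 v) => [u|//] /= bvu; split=> //.
  by apply/eqP => um; case: (L v); rewrite E um.
split=> //; first by apply: contraNneq (wf_par_neq v H) => {2}->; rewrite E.
by apply/eqP => vm; move: E; rewrite vm pm.
Qed.

Lemma wf_leb F b l i j : wf F b l -> F.2 i = F.2 j -> i != j ->
  b i <= b j -> b i < b j.
Proof.
move=> H pij ij; rewrite leq_eqVlt => /predU1P[/(wf_sibling H pij) E|//].
by rewrite E eqxx in ij.
Qed.

(** * The forest obtained from a marker *)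

Section AttachSpec.
Variables (F : forest_code N) (b : 'I_N -> nat) (l : 'I_N -> 'I_N) (z : marker).
Hypotheses (H : wf F b l) (isoF : iso F) (okz : marker_ok F z).
Let u := target F z.
Let a := bound F z.
Let G := attach F z.

(** When [u] joins the cycle of [v], the representative remains [v], because [b v < a <= b' u]. *)
Lemma attach_wf : exists b' l', [/\ wf G b' l',
  [/\ b' m = b u, a <= b' u & forall w, w != u -> w != m -> b' w = b w],
  forall w, w != u -> l' w = lconj u l w &
  l' u = (if z is inr (v, true) then v else u)].
Proof.
have [um au E] := marker_okP H isoF okz; rewrite -/u -/a in um au E *.
have [b' [W bm bw bu]] := wf_attach0 H isoF um au.
have [_ Fm _] := isoP _ isoF.
have mu : (m == u) = false by rewrite eq_sym (negPf um).
have lu : lconj u l u = u by rewrite /lconj tpermL (wf_fixed H Fm) tpermR.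
rewrite /G /attach /shift -/u -/a.
case Ez: z E => [u'|[v [|]]] E; exists b'; rewrite ?mul1g;
  try by exists (lconj u l).
case: E => pv lv av vu vm.
have Gu : (F.1 ^ tperm u m) u = u by rewrite tperm_conj tpermL Fm tpermR.
have lcv : lconj u l v = v.
  by rewrite /lconj (@tpermD _ u m v) 1?eq_sym // lv tpermD 1?eq_sym.
exists (fun w => if w == u then lconj u l v else lconj u l w).
have pvu : attach_par F u a v = Some m.
  by rewrite (attach_parE _ _ H) (negPf vu) (negPf vm) pv eqxx lv av ltnSn.
split=> //; last by rewrite eqxx.
- apply: (wf_perm W) => [w||w] /=.
  + rewrite permM (wf_par W) /=; case: tpermP => [->|->|//];
    by rewrite pvu (attach_parE _ _ H) eqxx.
  + exact: orbit_choice_insert (wf_choice W) Gu vu.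
  + case: eqP => [->|_]; last exact: wf_lead W w.
    by rewrite lcv bw //; move: bu; rewrite av; apply: ltnW.
- by move=> w /negPf ->.
Qed.

Definition marker_weight (R : Type) (y t : R) z := if z is inr (_, true) then t else y.

Lemma attach_spec : exists b' l', [/\ wf G b' l', G.2 u = Some m,
  (exists2 v, last_child G b' l' v & G.1 v = u), marker_spec G b' l' u z &
  forall (R : comNzRingType) (x y t : R),
    (x * \prod_i omega G b' l' x y t i =
     marker_weight y t z * \prod_i omega F b l x y t i)%R].
Proof.
have [b' [l' [W [bm bu bw] lw lu]]] := attach_wf.
have [um au zP] := marker_okP H isoF okz; rewrite -/u -/a in um au zP *.
have [/leafP L Fm pm] := isoP _ isoF.
have mu : m != u by rewrite eq_sym.
have Gp w : G.2 w = if w == u then Some m else if w == m then F.2 u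
  else if (F.2 w == Some u) && (b (l w) < a) then Some m else F.2 w.
  by rewrite -(attach_parE _ _ H).
have Gu : G.2 u = Some m by rewrite Gp eqxx.
have lE w : w != u -> w != m -> (l' w == w) = (l w == w).
  move=> wu wm; have tw : tperm u m w = w by rewrite tpermD 1?eq_sym.
  by rewrite lw // /lconj -{2}tw (inj_eq perm_inj) tw.
have chm w : w != u -> G.2 w = Some m -> l' w = w ->
    [/\ w != m, F.2 w = Some u, b' w = b w & b w < a].
  move=> wu pw lww.
  have wm : w != m.
    by apply/eqP => wm; move: (wf_par_neq w W); rewrite pw wm eqxx.
  move: pw; rewrite Gp (negPf wu) (negPf wm) bw //.
  case: ifP => [/andP[/eqP -> ba] _|_ /L//]; split=> //.
  by move/eqP: lww ba; rewrite lE // => /eqP ->.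
have s5u : (F.1 ^ tperm u m) u = u by rewrite tperm_conj tpermL Fm tpermR.
have GE w : G.1 w = (F.1 ^ tperm u m)
    ((if z is inr (v, true) then tperm v u else 1) w) by rewrite -permM.
exists b', l'; split=> //.
- case Ez: z zP lu GE => [u'|[v e]] zP lu GE.
    exists u; last by rewrite GE perm1.
    split=> // w pw lww; have [->//|wu] := eqVneq w u.
    by have [_ _ _] := chm w wu pw lww; rewrite zP.
  case: zP => pv lv av vu vm.
  have pGv : G.2 v = Some m.
    by rewrite Gp (negPf vu) (negPf vm) pv eqxx lv av ltnSn.
  have lv' : l' v = v by apply/eqP; rewrite lE ?lv ?eqxx //.
  have vmax w : w != u -> G.2 w = Some m -> l' w = w -> b' w <= b' v.
    move=> wu pw lww; have [_ _ -> ba] := chm w wu pw lww.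
    by rewrite (bw v) //; move: ba; rewrite av ltnS.
  case: e lu GE {Ez} => lu GE; [exists v|exists u].
  + split=> // w pw lww; have [wu|wu] := eqVneq w u; last exact: vmax.
    by move: lww; rewrite wu lu => uv; rewrite uv eqxx in vu.
  + by rewrite GE tpermL.
  + split=> // w pw lww; have [->//|wu] := eqVneq w u.
    have [_ _ -> ba] := chm w wu pw lww; exact: leq_trans (ltnW ba) bu.
  + by rewrite GE perm1.
- case Ez: z zP lu GE => [u'|[v e]] zP lu GE /=.
    split=> [|w pw]; first by rewrite GE perm1.
    apply/eqP; apply: contraT => wu.
    move: pw; rewrite Gp (negPf wu) zP ltn0 andbF.
    case: ifP => [/eqP wm pu|_ /L//]; by case: (L u).
  case: zP => pv lv av vu vm.
  have pGv : G.2 v = Some m.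
    by rewrite Gp (negPf vu) (negPf vm) pv eqxx lv av ltnSn.
  have lv' : l' v = v by apply/eqP; rewrite lE ?lv ?eqxx //.
  split=> //.
  + rewrite GE; case: e lu {Ez GE} => lu /=; last first.
      by rewrite perm1 s5u eqxx.
    rewrite tpermR -{2}s5u (inj_eq perm_inj); exact: negPf.
  + move=> w wu pw lww; have [_ _ -> ba] := chm w wu pw lww.
    by rewrite (bw v) //; move: ba; rewrite av ltnS.
- move=> R x y t.
  (* [m] takes over the factor of [u], and [u] receives the weight of the marker. The factor [x] of
     the isolated [m] is lost, so it is restored on the left. *)
  rewrite (bigD1 m) //= (bigD1 u) //= [in RHS](bigD1 m) //= [in RHS](bigD1 u) //=.
  have -> : omega F b l x y t m = x.
    by rewrite /omega (wf_fixed H Fm) eqxx pm.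
  have -> : omega G b' l' x y t m = omega F b l x y t u.
    rewrite /omega lw // Gp (negPf mu) eqxx bm /lconj tpermR.
    by rewrite -(inj_eq (@perm_inj _ (tperm u m)) (l u) u) tpermL.
  have -> : omega G b' l' x y t u = marker_weight y t z.
    rewrite /omega Gu (leq_ltn_trans (wf_le W u) (ltn_max um)) lu.
    rewrite /marker_weight; case: z zP => [u'|[v [|]]] //=; rewrite ?eqxx //.
    by case=> _ _ _ /negPf ->.
  (* A moved edge has beta below [a <= u], so it was improper, and it stays so under the larger
     label [m]. *)
  rewrite (eq_bigr (omega F b l x y t)); last first.
    move=> w /andP[wm wu]; rewrite /omega lE //; case: eqP => //= lww.
    rewrite Gp (negPf wu) (negPf wm) bw //.
    case: ifP => [/andP[/eqP -> ]|_ //]; rewrite lww => ba.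
    by rewrite (leq_trans ba au) (leq_ltn_trans (wf_le H w) (ltn_max wm)).
  by rewrite [RHS]mulrCA; congr (_ * _)%R; rewrite mulrCA.
Qed.
End AttachSpec.

(** * Recovery of the forest and of the marker *)

Lemma last_child_unique G b l b' l' v v' : wf G b l -> wf G b' l' ->
  last_child G b l v -> last_child G b' l' v' -> v = v'.
Proof.
move=> H H'; have [bb ll] := wf_unique H H'.
case=> [pv lv vmax] [pv' lv' vmax']; apply: (wf_sibling H); first by rewrite pv pv'.
have := vmax' v pv; rewrite -ll -!bb => /(_ lv) le1.
by apply/eqP; rewrite eqn_leq le1 vmax // ll.
Qed.

Lemma marker_spec_unique G b l b' l' u z z' : wf G b l -> wf G b' l' ->
  marker_spec G b l u z -> marker_spec G b' l' u z' ->
  (if z is inl u1 then u1 = u else True) ->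
  (if z' is inl u1 then u1 = u else True) -> z = z'.
Proof.
move=> H H'; have [bb ll] := wf_unique H H'.
case: z z' => [u1|[v e]] [u2|[v' e']] /=.
- by move=> _ _ -> ->.
- by case=> _ uniq_u [_ vu pv]; rewrite (uniq_u _ pv) eqxx in vu.
- by case=> _ vu pv _ _ [_ uniq_u]; rewrite (uniq_u _ pv) eqxx in vu.
case=> ee vu pv lv vmax [ee' vu' pv' lv' vmax'] _ _.
have <- : e = e' by apply: negb_inj; rewrite -ee -ee'.
congr (inr (_, _)); apply: (wf_sibling H); first by rewrite pv pv'.
have := vmax' v vu pv; rewrite -ll -!bb => /(_ lv) le1.
by apply/eqP; rewrite eqn_leq le1 vmax // ll.
Qed.

(** As [m] was a leaf, every child of [m] in the new forest except [u] came from [u] and goes back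
    there. *)
Lemma attach_parK F u a w : leaf F -> F.2 m = None -> u != m -> F.2 w =
  let p := attach_par F u a in
  if w == u then p m else if w == m then None
  else if p w == Some m then Some u else p w.
Proof.
move=> /leafP L pm um; rewrite /= !ffunE eqxx (eq_sym m) (negPf um).
have [->//|wu] := eqVneq w u; have [->//|wm] := eqVneq w m.
case A: (_ && _); first by case/andP: A => /eqP-> _; rewrite eqxx.
by case: eqP => [/L|].
Qed.

(** First [u] is recovered as the successor of the last child, then the marker, then the parents.
    Cancelling the shift and the conjugation gives the cycles. *)
Lemma attach_inj F F' z z' :
  valid_forest F -> iso F -> marker_ok F z ->
  valid_forest F' -> iso F' -> marker_ok F' z' ->
  attach F z = attach F' z' -> F = F' /\ z = z'.
Proof.
move=> /valid_wf[b [l H]] isoF okz /valid_wf[b' [l' H']] isoF' okz' E.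
have [c [k [W pu [v lv Gv] zs _]]] := attach_spec H isoF okz.
have [c' [k' [W' pu' [v' lv' Gv'] zs' _]]] := attach_spec H' isoF' okz'.
have [um _ _] := marker_okP H isoF okz.
rewrite -E in W' pu' lv' Gv' zs'.
have uu : target F z = target F' z'.
  by rewrite -Gv -Gv' (last_child_unique W W' lv lv').
have zz : z = z'.
  rewrite -uu in zs'.
  apply: (marker_spec_unique W W' zs zs') => //; first by case: (z).
  by rewrite uu; case: (z').
split=> //; subst z'.
have [L Fm pm] := isoP _ isoF; have [L' Fm' pm'] := isoP _ isoF'.
have pE : F.2 = F'.2.
  case: E => _ /ffunP E; apply/ffunP => w.
  rewrite (@attach_parK F (target F z) (bound F z) w L pm um).
  have um' : target F' z != m by rewrite -uu.
  by rewrite (@attach_parK F' (target F' z) (bound F' z) w L' pm' um') /= !E uu.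
case: F F' E pE uu {H isoF okz H' isoF' okz' W W' pu pu' lv lv' Gv Gv' zs zs' um L Fm pm L' Fm' pm'}
  => s p [s' p'] [E _] /= pp uu; subst p'; congr (_, _).
move: E; rewrite /shift -uu => /mulgI /conjg_inj; exact.
Qed.

(** * The inverse operation, for a child [u] of [m] alone in its cycle *)

Section Detach.
Variables (G : forest_code N) (b : 'I_N -> nat) (l : 'I_N -> 'I_N) (u : 'I_N).
Hypotheses (H : wf G b l) (Gu : G.1 u = u) (pu : G.2 u = Some m).

Definition detach : forest_code N := (G.1 ^ tperm u m,
  [ffun w => if w == u then G.2 m else if w == m then None
    else if G.2 w == Some m then Some u else G.2 w]).

Lemma detach_neq : u != m.
Proof. by have := wf_par_neq u H; rewrite pu; apply: contraNneq => ->. Qed.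

Lemma wf_detach : wf detach
  (fun w => if w == m then m : nat else if w == u then b m else b w) (lconj u l).
Proof.
have um := detach_neq.
have mu : (m == u) = false by rewrite eq_sym (negPf um).
have pmm := wf_par_neq m H.
have pmu : G.2 m != Some u := wf_parC H pu.
have Gn i : (G.1 i == u) = (i == u) by rewrite -{1}Gu (inj_eq perm_inj).
have lu : l u = u := wf_fixed H Gu.
have ln i : i != u -> l i != u.
  move=> im; apply: contraNneq im => lim.
  by have := (wf_choice H).2 i; rewrite lim porbit_sym => /(porbit_fix Gu) ->.
have bmu : b m <= b u := wf_mono H pu.
split=> /=.
- move=> w; rewrite tperm_conj; case: (tpermP u m w) => [->|->|/eqP wu /eqP wm].
  + have [->|Fm] := eqVneq (G.1 m) m; first by rewrite tpermR.
    rewrite tpermD 1?eq_sym ?Gn ?mu // !ffunE Gn mu (negPf Fm) eqxx.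
    by rewrite (wf_par H) (negPf pmm).
  + by rewrite Gu tpermL.
  + have [Fw|Fw] := eqVneq (G.1 w) m.
      have pwm : G.2 w = G.2 m by rewrite -Fw (wf_par H).
      by rewrite Fw tpermR !ffunE eqxx (negPf wu) (negPf wm) pwm (negPf pmm).
    rewrite tpermD 1?eq_sym ?Gn // !ffunE Gn (negPf wu) (negPf wm) (negPf Fw).
    by rewrite (wf_par H).
- case: (wf_rank H) => r rP; have rmu := rP _ _ pu.
  exists (fun w => if w == u then r m else r w) => i j; rewrite !ffunE.
  have [_ pm|ju] := eqVneq j u.
    by rewrite ifN ?rP //; apply: contraNneq pmu => <-; rewrite pm.
  have [//|jm] := eqVneq j m.
  case: eqP => [/rP mj [<-]|_ pj]; first by rewrite eqxx.
  by have := rP _ _ pj; case: eqP => [->|_]; lia.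
- move=> i; case: eqP => [->//|_]; case: eqP => [->|_]; last exact: (wf_le H).
  exact: leq_trans bmu (wf_le H u).
- move=> i j; rewrite ffunE.
  have [_ pm|ju] := eqVneq j u.
    rewrite ifN; last by apply: contraNneq pmm => E; rewrite -{2}E pm.
    rewrite ifN; last by apply: contraNneq pmu => E; rewrite -E pm.
    case: eqP => _; last exact: (wf_mono H).
    exact: leq_trans (wf_le H i) (leq_ord i).
  have [//|jm] := eqVneq j m.
  case: eqP => [mj [<-]|nj pj].
    by rewrite (negPf um) eqxx; apply: (wf_mono H).
  rewrite ifN; last by apply/eqP => E; case: nj; rewrite pj E.
  case: eqP => [E|_]; last exact: (wf_mono H).
  by rewrite E in pj; apply: leq_trans bmu (wf_mono H pj).
- move=> i; have [->|im] := eqVneq i m; first by left.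
  have [->|iu] := eqVneq i u.
    (* A former child [c] of [m] or of [u] ends up below [u], so it can attest the new beta of
       [u]. *)
    have att c : c != u -> c != m -> G.2 c = Some m \/ G.2 c = Some u -> b m = b c ->
      b m = u \/ exists2 j, [ffun w => if w == u then G.2 m else if w == m then None
        else if G.2 w == Some m then Some u else G.2 w] j = Some u &
        b m = if j == m then m : nat else if j == u then b m else b j.
      move=> cu cm pc bc; right; exists c; rewrite ?ffunE (negPf cu) (negPf cm) //.
      by case: pc => ->; rewrite ?eqxx //; case: eqP.
    have nm c : G.2 c = Some m -> c != m.
      by move=> pc; apply: contraNneq pmm => E; rewrite -{1}E pc.
    (* The label of [m] is not its beta, because its child [u] has a smaller label. *)
    case: (wf_att H m) => [E|[c cm bc]].
      by have := wf_le H u; have := ltn_max um; lia.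
    have [cu|cu] := eqVneq c u; last by apply: (att c) => //; [exact: nm|left].
    rewrite cu in bc; case: (wf_att H u) => [<-|[d du bd]]; first by left.
    apply: (att d); rewrite ?bc //; last by right.
      by apply: contraNneq (wf_par_neq u H) => E; rewrite -{1}E du.
    by apply: contraNneq pmu => E; rewrite -E du.
  case: (wf_att H i) => [|[j ji bj]]; first by left.
  right; have [jm|jm] := eqVneq j m.
    exists u; first by rewrite ffunE eqxx -jm.
    by rewrite (negPf um) eqxx bj jm.
  have ju : j != u by apply: contraNneq im => E; move: ji; rewrite E pu => -[->].
  exists j; last by rewrite (negPf jm) (negPf ju).
  rewrite ffunE (negPf jm) (negPf ju) ifN //.
  by apply: contraNneq im; rewrite ji => -[->].
- exact: lconj_choice (wf_choice H).
- move=> w; rewrite /lconj; case: (tpermP u m w) => [->|->|/eqP wu /eqP wm].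
  + case: (tpermP u m (l m)) => [lm|lm|/eqP lm /eqP lm'].
    * by have := ln m; rewrite lm eqxx eq_sym um => /(_ isT).
    * by rewrite (negPf um) eqxx.
    * by rewrite (negPf um) eqxx (negPf lm) (negPf lm') (wf_lead H).
  + by rewrite lu tpermL eqxx.
  + rewrite (negPf wu) (negPf wm).
    case: (tpermP u m (l w)) => [lw|lw|/eqP lw /eqP lw'].
    * by have := ln w wu; rewrite lw eqxx.
    * by rewrite (negPf um) eqxx -lw (wf_lead H).
    * by rewrite (negPf lw) (negPf lw') (wf_lead H).
Qed.

Lemma iso_detach : iso detach.
Proof.
have um := detach_neq; apply/isoP; split.
- apply/leafP => w; rewrite ffunE.
  case: eqP => [_ E|_]; first by have := wf_par_neq m H; rewrite E eqxx.
  case: eqP => // _; case: eqP => [_ [E]|//].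
  by rewrite E eqxx in um.
- by rewrite /= tperm_conj tpermR Gu tpermL.
- by rewrite /= ffunE eq_sym (negPf um) eqxx.
Qed.
End Detach.

Lemma last_child_exists G b l : wf G b l -> ~~ leaf G -> exists v, last_child G b l v.
Proof.
move=> H /forallPn[w /negPn/eqP pw].
pose P v := (G.2 v == Some m) && (l v == v).
have Pl : P (l w) by rewrite /P (wf_par_lead H) pw (wf_leadI _ H) !eqxx.
case: (arg_maxnP b Pl) => v /andP[/eqP pv /eqP lv] vmax.
exists v; split=> // c pc lc; apply: vmax; by rewrite /P pc lc !eqxx.
Qed.

Lemma attach_surj G : valid_forest G -> ~~ leaf G ->
  exists F z, [/\ valid_forest F, iso F, marker_ok F z & attach F z = G].
Proof.
move=> /valid_wf[b [l H]] Lf; have [v [pv lv vmax]] := last_child_exists H Lf.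
pose u := G.1 v; have pu : G.2 u = Some m by rewrite (wf_par H).
(* [t] takes [u] out of the cycle of [v] unless [u] is alone; being an involution, it is also the
   shift that puts [u] back. *)
pose t : {perm 'I_N} := if v == u then 1 else tperm v u.
pose l2 w := if w == u then u else l w.
have lu : l u = v by rewrite /u (wf_choice H).1.
have t2 : t * t = 1 by rewrite /t; case: eqP => _; rewrite ?mul1g ?tperm2.
have S_u : (t * G.1) u = u.
  by rewrite permM /t; case: eqP => [E|_]; rewrite ?perm1 ?tpermR // -{1}E.
have choice2 : orbit_choice (t * G.1) l2.
  rewrite /t; case: eqP => [E|/eqP vu].
    rewrite mul1g; split=> w; rewrite /l2.
      have -> : (G.1 w == u) = (w == u) by rewrite {1}/u (inj_eq perm_inj) E.
      by rewrite (wf_choice H).1.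
    case: eqP => [->|_]; first exact: porbit_id.
    exact: (wf_choice H).2.
  have lcu : l u != u by rewrite lu.
  exact: (orbit_choice_remove (wf_choice H) (erefl u) vu lcu).
have pt w : G.2 (t w) = G.2 w.
  rewrite /t; case: eqP => _; first by rewrite perm1.
  by case: tpermP => [->|->|//]; rewrite pu pv.
have W : wf (t * G.1, G.2) b l2.
  apply: (wf_perm H) => // w; first by rewrite permM (wf_par H) pt.
  by rewrite /l2; case: eqP => [->|_] //; apply: (wf_lead H).
pose F := detach (t * G.1, G.2) u.
have HF : wf F _ _ := wf_detach W S_u pu.
have isoF : iso F := iso_detach W S_u pu.
have um : u != m := detach_neq W pu.
have l2u w : w != u -> l2 w = l w by rewrite /l2 => /negPf->.
have nm w : G.2 w = Some m -> w != m.
  by move=> pw; apply: contraNneq (wf_par_neq m H) => E; rewrite -{1}E pw.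
have vle : v != u -> b v < b u.
  move=> vu; apply: (wf_leb H) => //; first by rewrite pu.
  by rewrite -lu; apply: (wf_lead H).
have [z [zu zl zt z0 zv]] : exists z, [/\
    (if z is inr (c, _) then
       [/\ c != u, G.2 c = Some m, l2 c = c & b c < b u] else True),
    (if z is inl c then c = u else True),
    (if z is inr (c, true) then tperm c u else 1) = t,
    (if z is inl _ then forall w, w != u -> G.2 w <> Some m else True) &
    (if z is inr (c, _) then forall w, w != u -> G.2 w = Some m ->
      l2 w = w -> b w <= b c else True)].
  (* If [u] shares its cycle with [v], the marker is [(v, true)]. Otherwise it is the last of the
     other representatives below [m], with [false], or [inl u] if there is none. *)
  have [vu|vu] := eqVneq v u; last first.
    exists (inr (v, true)); split=> //; rewrite ?l2u ?vle //.
      by rewrite /t (negPf vu).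
    by move=> w wu pw; rewrite l2u // => lw; apply: vmax.
  pose P w := [&& w != u, G.2 w == Some m & l2 w == w].
  case: (pickP P) => [c0 Pc0|P0].
    case: (arg_maxnP b Pc0) => c /and3P[cu /eqP pc /eqP lc] cmax.
    exists (inr (c, false)); split=> //.
    - split=> //; apply: (wf_leb H) => //; first by rewrite pu.
      by rewrite -{1}vu vmax // -l2u.
    - by rewrite /t vu eqxx.
    - by move=> w wu pw lw; apply: cmax; rewrite /P wu pw lw !eqxx.
  exists (inl u); split=> //; first by rewrite /t vu eqxx.
  move=> w wu pw; have := P0 (l2 w).
  rewrite /P (wf_par_lead W) /= pw eqxx (wf_leadI _ W) eqxx !andbT.
  rewrite l2u // => /negbFE/eqP lwu.
  have fixu : G.1 u = u by rewrite -{1}vu.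
  have := (wf_choice H).2 w; rewrite lwu porbit_sym => /(porbit_fix fixu) E.
  by rewrite E eqxx in wu.
exists F, z.
have Fp w : F.2 w = if w == u then G.2 m else if w == m then None
    else if G.2 w == Some m then Some u else G.2 w by rewrite ffunE.
have tz : target F z = u.
  case: z zu zl {zt z0 zv} => [c|[c e]] //= [cu pc _ _] _.
  by rewrite ffunE (negPf cu) (negPf (nm _ pc)) pc eqxx.
split=> //; first exact: wf_valid HF.
  (* In [F] the edge from [u] to [c] is improper: the beta of [c] is below that of [u] in [G], hence
     below the label [u]. *)
  case: z zu zl tz {zt z0 zv} => [c _ -> //|[c e]] /= [cu pc lc bc] _ tz.
  have cm := nm _ pc.
  rewrite (wf_improper HF) Fp (negPf cu) (negPf cm) pc eqxx.
  rewrite /lconj (@tpermD _ u m c) 1?eq_sym // lc tpermD 1?eq_sym // eqxx.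
  exact: leq_trans bc (wf_le H u).
rewrite /attach; have -> : shift F z = t by rewrite /shift tz.
rewrite tz [F.1]/= -conjgM tperm2 conjg1 mulgA t2 mul1g.
have -> : attach_par F u (bound F z) = G.2; last by case: (G).
apply/ffunP => w; rewrite (attach_parE _ _ HF) !Fp eqxx.
have [->|wu] := eqVneq w u; first by rewrite pu.
have [->//|wm] := eqVneq w m.
have lw2 : l2 w != u -> l2 w != m -> lconj u l2 w = l2 w.
  by move=> ??; rewrite /lconj (@tpermD _ u m w) 1?eq_sym // tpermD 1?eq_sym.
have pl2 : G.2 (l2 w) = G.2 w := wf_par_lead W w.
have l2wu : l2 w != u.
  apply: contraNneq wu => E; have := choice2.2 w.
  by rewrite E porbit_sym => /(porbit_fix S_u) ->.
(* Children of [m] in [G] move back to it, because [c] is the last of them apart from [u]. Children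
   of [u] in [G] stay, since their beta is at least that of [u], which exceeds that of [c]. *)
have [pw|npw] := eqVneq (G.2 w) (Some m).
  rewrite eqxx /= lw2 ?(negPf l2wu) ?(negPf (nm _ _)) ?pl2 //.
  case: z tz zu z0 zv {zl zt} => [c _ _ /(_ w wu)//|[c e] _ /= [cu pc _ _] _ zv].
  rewrite (wf_beta HF) (negPf cu) (negPf (nm _ pc)) ltnS zv ?pl2 ?pw //.
  exact: wf_leadI W.
have [pw|//] := eqVneq (G.2 w) (Some u); rewrite ifN //= -leqNgt.
have l2m : l2 w != m.
  apply/eqP => E; move: pl2; rewrite E pw => pmu.
  by have := wf_parC H pu; rewrite pmu eqxx.
rewrite lw2 // (negPf l2wu) (negPf l2m).
case: z tz zu {zl zt z0 zv} => [//|[c e] _ /= [cu pc _ bc]].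
rewrite (wf_beta HF) (negPf cu) (negPf (nm _ pc)); apply: leq_trans bc _.
by apply: (wf_mono H); rewrite pl2.
Qed.

(** * Insertion of [m] as a leaf *)

Section LeafInsertion.
Variables (F : forest_code N) (b : 'I_N -> nat) (l : 'I_N -> 'I_N) (i : 'I_N).
Hypotheses (H : wf F b l) (isoF : iso F) (im : i != m).

(** The edge to [m] is proper, since the beta of [m] is the largest label; the factor of [m] changes
    from [x] to 1. *)
Lemma insert_child_spec : [/\ wf (insert_child F i) b l,
  leaf (insert_child F i) & forall (R : comNzRingType) (x y t : R),
    (x * \prod_j omega (insert_child F i) b l x y t j =
     \prod_j omega F b l x y t j)%R].
Proof.
have [L Fm pm] := isoP _ isoF.
have W : wf (insert_child F i) b l.
  by apply: wf_updm => //; apply: contra_neq im => -[].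
split=> // [|R x y t].
  apply/leafP => w; rewrite ffunE; case: eqP => [_ [E]|_]; last exact/leafP.
  by move: im; rewrite E eqxx.
rewrite (bigD1 m) //= [in RHS](bigD1 m) //=.
have -> : omega F b l x y t m = x by rewrite /omega (wf_fixed H Fm) eqxx pm.
rewrite {1}/omega (wf_fixed H Fm) eqxx ffunE eqxx (leaf_b H L).
rewrite ltnNge leq_ord mul1r; congr (_ * _)%R; apply: eq_bigr => w wm.
by rewrite /omega ffunE (negPf wm).
Qed.

(** With the largest beta, [m] does not represent the cycle that it enters; its factor changes from
    [x] to [t]. *)
Lemma insert_cycle_spec : exists l', [/\ wf (insert_cycle F i) b l',
  leaf (insert_cycle F i) & forall (R : comNzRingType) (x y t : R),
    (x * \prod_j omega (insert_cycle F i) b l' x y t j =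
     t * \prod_j omega F b l x y t j)%R].
Proof.
have [L Fm pm] := isoP _ isoF; move/leafP: (L) => Lp.
have W : wf (F.1, updm F (F.2 i)) b l by apply: wf_updm => //; apply/eqP.
exists (fun w => if w == m then l i else l w); split.
- apply: (wf_perm W) => [w||w] /=.
  + rewrite permM; have := wf_par W (tperm i m w) => /= ->.
    by case: tpermP => [->|->|//]; rewrite !ffunE eqxx (negPf im).
  + exact: orbit_choice_insert (wf_choice H) Fm im.
  + case: eqP => [->|_]; last exact: wf_lead H w.
    by rewrite (leaf_b H L); apply: leq_trans (wf_le H _) (leq_ord _).
- by apply/leafP => w; rewrite ffunE; case: eqP.
move=> R x y t; rewrite (bigD1 m) //= [in RHS](bigD1 m) //=.
have -> : omega F b l x y t m = x by rewrite /omega (wf_fixed H Fm) eqxx pm.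
rewrite {1}/omega eqxx ifT; last first.
  apply: contraNneq im => lim.
  by have := (wf_choice H).2 i; rewrite lim porbit_sym => /(porbit_fix Fm) ->.
rewrite mulrCA; congr (_ * (_ * _))%R; apply: eq_bigr => w wm.
by rewrite /omega ffunE (negPf wm).
Qed.
End LeafInsertion.

Lemma updm_iso F (o : option 'I_N) : F.2 m = None ->
  updm (F.1, updm F o) None = F.2.
Proof.
by move=> pm; apply/ffunP => w; rewrite !ffunE; case: eqP => [->|].
Qed.

Lemma insert_child_inj F F' i i' : F.2 m = None -> F'.2 m = None ->
  insert_child F i = insert_child F' i' -> F = F' /\ i = i'.
Proof.
move=> pm pm' [E1 E2]; split; last first.
  by move/ffunP/(_ m): E2; rewrite !ffunE eqxx => -[].
rewrite (surjective_pairing F) (surjective_pairing F') -E1; congr (_, _).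
by rewrite -(updm_iso (Some i) pm) -(updm_iso (Some i') pm') -E1 E2.
Qed.

Lemma insert_cycle_inj F F' i i' : iso F -> iso F' ->
  insert_cycle F i = insert_cycle F' i' -> F = F' /\ i = i'.
Proof.
move=> /isoP[_ Fm pm] /isoP[_ Fm' pm'] [E1 E2].
(* On both sides this is the predecessor of [m] in the new cycles. *)
have ii : i = i'.
  apply: (@perm_inj _ (tperm i m * F.1)); rewrite {2}E1 !permM !tpermL.
  by rewrite Fm Fm'.
split=> //; rewrite -ii in E1 E2; move/mulgI: E1 => E1.
rewrite (surjective_pairing F) (surjective_pairing F') -E1; congr (_, _).
by rewrite -(updm_iso (F.2 i) pm) -(updm_iso (F'.2 i) pm') -E1 E2.
Qed.

Lemma updm_None_iso G : leaf G -> iso ((if G.1 m == m then G.1 else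
  tperm (G.1^-1 m) m * G.1), updm G None).
Proof.
move=> /leafP L; apply/isoP; split; last by rewrite ffunE eqxx.
  by apply/leafP => w; rewrite ffunE; case: eqP.
by case: eqP => //= _; rewrite permM tpermR permKV.
Qed.

Lemma insert_child_surj G : valid_forest G -> leaf G -> G.1 m = m ->
  G.2 m != None ->
  exists F i, [/\ valid_forest F, iso F, i != m & insert_child F i = G].
Proof.
move=> /valid_wf[b [l H]] L Gm; case E: (G.2 m) => [i|//] _.
exists (G.1, updm G None), i; split.
- by apply: wf_valid; apply: wf_updm H L Gm _.
- by have := updm_None_iso L; rewrite Gm eqxx.
- by apply: contraTneq (wf_par_neq m H) => im; rewrite E im eqxx.
rewrite (surjective_pairing G); congr (_, _); apply/ffunP => w.
by rewrite !ffunE /=; case: eqP => [->|].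
Qed.

Lemma insert_cycle_surj G : valid_forest G -> leaf G -> G.1 m != m ->
  exists F i, [/\ valid_forest F, iso F, i != m & insert_cycle F i = G].
Proof.
move=> /valid_wf[b [l H]] L Gm; set i := G.1^-1 m.
have Gi : G.1 i = m by rewrite permKV.
have im : i != m by apply: contra_neq Gm => {1}<-.
have pim : G.2 m = G.2 i by rewrite -Gi (wf_par H).
(* The successor of [m] has a label, hence a beta, smaller than that of [m]. *)
have lm : l m != m.
  apply/eqP => lm; have := wf_lead H (G.1 m).
  rewrite (wf_choice H).1 lm (leaf_b H L) leqNgt.
  by rewrite (leq_ltn_trans (wf_le H _)) // ltn_max.
have W : wf (tperm i m * G.1, G.2) b (fun w => if w == m then m else l w).
  apply: (wf_perm H) => [w||w].
  - rewrite permM (wf_par H).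
    by case: tpermP => [->|->|]; rewrite ?pim.
  - exact: orbit_choice_remove (wf_choice H) Gi im lm.
  - by case: eqP => [->|_] //; apply: (wf_lead H).
exists (tperm i m * G.1, updm G None), i; split=> //.
- apply: wf_valid; apply: (wf_updm W) => //.
  by rewrite /= permM tpermR.
- by have := updm_None_iso L; rewrite (negPf Gm).
rewrite [G in RHS](surjective_pairing G); congr (_, _).
  by rewrite /= mulgA tperm2 mul1g.
apply/ffunP => w; rewrite !ffunE /= (negPf im).
by case: eqP => [->|].
Qed.
End Insertion.

(** * Change of index in sums, and forests with an isolated largest vertex *)

Lemma sum_bijection (R : nmodType) (I J : finType) (P : pred I) (Q : pred J)
    (h : I -> J) (w : J -> R) :
  (forall i, P i -> Q (h i)) ->
  (forall i j, P i -> P j -> h i = h j -> i = j) ->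
  (forall j, Q j -> exists2 i, P i & h i = j) ->
  (\sum_(j | Q j) w j = \sum_(i | P i) w (h i))%R.
Proof.
move=> PQ inj surj.
have hI : {in [set i | P i] &, injective h}.
  by move=> i j; rewrite !inE; apply: inj.
rewrite [RHS](eq_bigl (fun i => i \in [set i | P i])) => [|i]; last by rewrite inE.
rewrite -(big_imset w hI).
apply: eq_bigl => j; apply/idP/imsetP => [/surj[i Pi <-]|[i]].
  by exists i; rewrite ?inE.
by rewrite inE => Pi ->; apply: PQ.
Qed.

Section Lift.
Variable n : nat.
Local Notation m := (@ord_max n).
Implicit Types F : forest_code n.

(** Adding [m] as an isolated vertex identifies forests on [n] labels with those satisfying [iso],
    so that the insertions keep the vertex set fixed. *)
Definition lift_forest F : forest_code n.+1 := (lift_perm m m F.1,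
  [ffun i => if unlift m i is Some j then omap (lift m) (F.2 j) else None]).

Lemma lift_forest_lift F j : (lift_forest F).2 (lift m j) = omap (lift m) (F.2 j).
Proof. by rewrite ffunE liftK. Qed.

Lemma lift_forest_max F : (lift_forest F).2 m = None.
Proof. by rewrite ffunE unlift_none. Qed.

Definition lift_b (b : 'I_n -> nat) i := if unlift m i is Some j then b j else n.
Definition lift_l (l : 'I_n -> 'I_n) i :=
  if unlift m i is Some j then lift m (l j) else m.

Lemma lift_forest_par F i j : (lift_forest F).2 j = Some i ->
  exists i' j', [/\ i = lift m i', j = lift m j' & F.2 j' = Some i'].
Proof.
case: (unliftP m j) => [j' ->|->]; last by rewrite lift_forest_max.
rewrite lift_forest_lift; case E: (F.2 j') => [i'|] //= [<-].
by exists i', j'.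
Qed.

Lemma wf_lift F b l : wf F b l -> wf (lift_forest F) (lift_b b) (lift_l l).
Proof.
move=> H.
have bE j : lift_b b (lift m j) = b j by rewrite /lift_b liftK.
have lE j : lift_l l (lift m j) = lift m (l j) by rewrite /lift_l liftK.
have lm : lift_l l m = m by rewrite /lift_l unlift_none.
have bm : lift_b b m = n by rewrite /lift_b unlift_none.
split.
- move=> i; case: (unliftP m i) => [j ->|->]; last by rewrite lift_perm_id.
  by rewrite lift_perm_lift !lift_forest_lift (wf_par H).
- case: (wf_rank H) => r rP; exists (lift_b r) => i j.
  case/lift_forest_par=> i' [j' [-> -> /rP]].
  by rewrite /lift_b !liftK.
- move=> i; case: (unliftP m i) => [j ->|->]; last by rewrite bm.
  by rewrite bE lift_max (wf_le H).
- move=> i j /lift_forest_par[i' [j' [-> -> /(wf_mono H)]]].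
  by rewrite !bE.
- move=> i; case: (unliftP m i) => [j ->|->]; last by left.
  rewrite bE lift_max; case: (wf_att H j) => [|[c cj bc]]; first by left.
  right; exists (lift m c); rewrite ?bE //.
  by rewrite lift_forest_lift cj.
- split=> i; case: (unliftP m i) => [j ->|->].
  + by rewrite lift_perm_lift !lE (wf_choice H).1.
  + by rewrite lift_perm_id.
  + rewrite lE; apply: (porbit_map (f := lift m)) ((wf_choice H).2 j) => x.
    by rewrite -(lift_perm_lift m m F.1) mem_porbit1.
  + by rewrite lm porbit_id.
- move=> i; case: (unliftP m i) => [j ->|->]; last by rewrite lm.
  by rewrite lE !bE (wf_lead H).
Qed.

Lemma lift_forest_iso F : iso (lift_forest F).
Proof.
apply/isoP; split; rewrite ?lift_forest_max //= ?lift_perm_id //.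
apply/leafP => j jm; case: (lift_forest_par jm) => i' [j' [im _ _]].
by have := neq_lift m i'; rewrite -im eqxx.
Qed.

Lemma lift_forest_inj : injective lift_forest.
Proof.
move=> [s p] [s' p'] E.
have li := @lift_inj _ m.
congr (_, _).
  apply/permP => i; apply: li.
  by rewrite -!(lift_perm_lift m m); case: E => ->.
apply/ffunP => i; have /(_ li) inj := @inj_omap _ _ (lift m); apply: inj.
have := lift_forest_lift (s, p) i; rewrite E lift_forest_lift => /= ->.
by [].
Qed.

Lemma lift_forest_surj (G : forest_code n.+1) : valid_forest G -> iso G ->
  exists2 F, valid_forest F & lift_forest F = G.
Proof.
move=> /valid_forestP[Gp [r rP]] /isoP[/leafP L Gm pm].
have ne i : G.1 (lift m i) != m.
  by rewrite -{2}Gm (inj_eq perm_inj) eq_sym neq_lift.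
pose f i := odflt i (unlift m (G.1 (lift m i))).
have fE i : lift m (f i) = G.1 (lift m i).
  rewrite /f; case: unliftP => [j ->//|E]; by have := ne i; rewrite E eqxx.
have f_inj : injective f.
  move=> i j E; apply: (@lift_inj _ m); apply: (@perm_inj _ G.1).
  by rewrite -!fE E.
pose F : forest_code n := (perm f_inj, [ffun i => obind (unlift m) (G.2 (lift m i))]).
have FE i : omap (lift m) (F.2 i) = G.2 (lift m i).
  rewrite ffunE; case E: (G.2 (lift m i)) => [j|] //=.
  by case: unliftP => [k ->//|jm]; case: (L (lift m i)); rewrite E jm.
exists F.
  apply/valid_forestP; split.
    by move=> i; rewrite !ffunE /= permE fE Gp.
  exists (fun i => r (lift m i)) => i j ji; apply: rP.
  by rewrite -FE ji.
rewrite (surjective_pairing G); congr (_, _).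
  apply/permP => i; case: (unliftP m i) => [j ->|->].
    by rewrite lift_perm_lift permE fE.
  by rewrite lift_perm_id Gm.
apply/ffunP => i; case: (unliftP m i) => [j ->|->]; last by rewrite lift_forest_max.
by rewrite lift_forest_lift FE.
Qed.
End Lift.

(** * Weights and the recurrence for their sum *)

Section Weight.
Local Open Scope ring_scope.
Variables (R : comNzRingType) (x y t : R).

(** The exponent [ntree F], one more than in [forest_gf], makes the weight a product of local
    factors; the surplus [x] is cancelled at the end. *)
Definition weight n (F : forest_code n) : R :=
  x ^+ ntree F * y ^+ imp F * t ^+ bdeg F.

Lemma weight_omega n (F : forest_code n) b l :
  wf F b l -> weight F = \prod_i omega F b l x y t i.
Proof. by move=> H; rewrite /weight (wf_weight H). Qed.

Lemma weight_lift n (F : forest_code n) : valid_forest F ->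
  weight (lift_forest F) = x * weight F.
Proof.
case/valid_wf=> b [l H].
rewrite (weight_omega (wf_lift H)) (weight_omega H) (bigD1_ord ord_max) //=.
congr (_ * _).
  by rewrite /omega lift_forest_max /lift_l unlift_none eqxx.
apply: eq_bigr => i _; rewrite /omega lift_forest_lift /lift_l /lift_b liftK.
rewrite (inj_eq lift_inj); case: (F.2 i) => [u|] //.
by rewrite -[nat_of_ord u]lift_max.
Qed.

Lemma imp_lift n (F : forest_code n) : valid_forest F ->
  imp (lift_forest F) = imp F.
Proof.
case/valid_wf=> b [l H].
rewrite (wf_imp (wf_lift H)) (wf_imp H) -[RHS](card_imset _ (@lift_inj _ ord_max)).
apply: eq_card => i; rewrite inE.
case: (unliftP ord_max i) => [j ->|->].
  rewrite mem_imset ?inE; last exact: lift_inj.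
  rewrite lift_forest_lift /lift_l /lift_b liftK (inj_eq lift_inj).
  by case: (F.2 j) => [u|] //; rewrite -[nat_of_ord u]lift_max.
rewrite lift_forest_max andbF; symmetry; apply/imsetP => -[j _ E].
by have := neq_lift ord_max j; rewrite -E eqxx.
Qed.

Section Step.
Variable n : nat.
Local Notation m := (@ord_max n).
Local Notation N := n.+1.
Local Notation code := (forest_code n.+1).

Definition isolated (G : code) := valid_forest G && iso G.

Lemma sum_const_neq_max (c : R) : \sum_(i < N | i != m) c = c *+ n.
Proof.
rewrite sumr_const; congr (_ *+ _).
have := cardC1 m; rewrite card_ord => E; rewrite -[RHS]E.
by apply: eq_card => i; rewrite !inE.
Qed.

(** The factor [x] on the left matches the isolated vertex of the forests on the right. *)
Lemma sum_insert_child :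
  x * \sum_(G : code | [&& valid_forest G, leaf G, G.1 m == m & G.2 m != None])
        weight G
  = \sum_(F | isolated F) weight F *+ n.
Proof.
rewrite (@sum_bijection _ (code * 'I_N)%type _
   (fun Fi => isolated Fi.1 && (Fi.2 != m)) _ (fun Fi => insert_child Fi.1 Fi.2)).
- rewrite -(pair_big_dep isolated (fun _ i => i != m)
    (fun F i => weight (insert_child F i))) big_distrr /=.
  apply: eq_bigr => F /andP[v isoF]; rewrite -sum_const_neq_max big_distrr /=.
  apply: eq_bigr => i im; have [b [l H]] := valid_wf v.
  have [W _ wE] := insert_child_spec H isoF im.
  by rewrite (weight_omega H) (weight_omega W) wE.
- move=> [F i] /= /andP[/andP[v isoF] im]; have [b [l H]] := valid_wf v.
  have [W L _] := insert_child_spec H isoF im.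
  have [_ Fm _] := isoP _ isoF.
  by rewrite (wf_valid W) L ffunE eqxx /= Fm eqxx.
- move=> [F i] [F' i'] /= /andP[/andP[_ /isoP[_ _ pm]] _].
  by move=> /andP[/andP[_ /isoP[_ _ pm']] _] /(insert_child_inj pm pm')[-> ->].
- move=> G /and4P[v L /eqP Gm pm].
  have [F [i [vF isoF im E]]] := insert_child_surj v L Gm pm.
  by exists (F, i); rewrite //= /isolated vF isoF.
Qed.

Lemma sum_insert_cycle :
  x * \sum_(G : code | [&& valid_forest G, leaf G & G.1 m != m]) weight G
  = \sum_(F | isolated F) (t * weight F) *+ n.
Proof.
rewrite (@sum_bijection _ (code * 'I_N)%type _
   (fun Fi => isolated Fi.1 && (Fi.2 != m)) _ (fun Fi => insert_cycle Fi.1 Fi.2)).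
- rewrite -(pair_big_dep isolated (fun _ i => i != m)
    (fun F i => weight (insert_cycle F i))) big_distrr /=.
  apply: eq_bigr => F /andP[v isoF]; rewrite -sum_const_neq_max big_distrr /=.
  apply: eq_bigr => i im; have [b [l H]] := valid_wf v.
  have [l' [W _ wE]] := insert_cycle_spec H isoF im.
  by rewrite (weight_omega H) (weight_omega W) wE.
- move=> [F i] /= /andP[/andP[v isoF] im]; have [b [l H]] := valid_wf v.
  have [l' [W L _]] := insert_cycle_spec H isoF im.
  have [_ Fm _] := isoP _ isoF.
  rewrite (wf_valid W) L /= permM tpermR; apply: contraNneq im.
  by rewrite -{1}Fm => /perm_inj ->.
- move=> [F i] [F' i'] /= /andP[/andP[_ isoF] _] /andP[/andP[_ isoF'] _].
  by case/(insert_cycle_inj isoF isoF') => -> ->.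
- move=> G /and3P[v L Gm].
  have [F [i [vF isoF im E]]] := insert_cycle_surj v L Gm.
  by exists (F, i); rewrite //= /isolated vF isoF.
Qed.

Lemma sum_marker (F : code) (c d : R) :
  \sum_(z : marker n | marker_ok F z) marker_weight c d z =
  c *+ n + (c + d) *+ imp F.
Proof.
rewrite big_sumType /= sum_const_neq_max; congr (_ + _).
rewrite (eq_bigl (fun p => improper F p.1 && true)); last first.
  by case=> v e; rewrite andbT.
rewrite (eq_bigr (fun p => if p.2 then d else c)); last by case=> v [].
rewrite -(pair_big_dep (improper F) (fun _ _ => true)
   (fun v e => if e then d else c)) /=.
under eq_bigr => v _ do rewrite big_bool /= addrC.
by rewrite sumr_const; congr (_ *+ _); apply: eq_card => v; rewrite inE.
Qed.

Lemma sum_attach :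
  x * \sum_(G : code | valid_forest G && ~~ leaf G) weight G
  = \sum_(F | isolated F) (y *+ n + (y + t) *+ imp F) * weight F.
Proof.
rewrite (@sum_bijection _ (code * marker n)%type _
   (fun Fz => isolated Fz.1 && marker_ok Fz.1 Fz.2) _ (fun Fz => attach Fz.1 Fz.2)).
- rewrite -(pair_big_dep isolated (fun F z => marker_ok F z)
    (fun F z => weight (attach F z))) big_distrr /=.
  apply: eq_bigr => F /andP[v isoF].
  rewrite -sum_marker big_distrr big_distrl /=.
  apply: eq_bigr => z okz; have [b [l H]] := valid_wf v.
  have [b' [l' [W _ _ _ wE]]] := attach_spec H isoF okz.
  by rewrite (weight_omega H) (weight_omega W) wE.
- move=> [F z] /= /andP[/andP[v isoF] okz]; have [b [l H]] := valid_wf v.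
  have [b' [l' [W pu _ _ _]]] := attach_spec H isoF okz.
  by rewrite (wf_valid W); apply/leafP => /(_ _ pu).
- move=> [F z] [F' z'] /= /andP[/andP[v isoF] okz] /andP[/andP[v' isoF'] okz'].
  by case/(attach_inj v isoF okz v' isoF' okz') => -> ->.
- move=> G /andP[v L]; have [F [z [vF isoF okz E]]] := attach_surj v L.
  by exists (F, z); rewrite //= /isolated vF isoF.
Qed.

Lemma sum_isolated (f : R -> nat -> R) :
  \sum_(G : code | isolated G) f (weight G) (imp G) =
  \sum_(F : forest_code n | valid_forest F) f (x * weight F) (imp F).
Proof.
rewrite (@sum_bijection _ (forest_code n) _ (@valid_forest n) _ (@lift_forest n)).
- by apply: eq_bigr => F v; rewrite weight_lift // imp_lift.
- move=> F /valid_wf[b [l H]].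
  by rewrite /isolated (wf_valid (wf_lift H)) lift_forest_iso.
- by move=> F F' _ _ /lift_forest_inj.
- by move=> G /andP[v isoG]; have [F vF E] := lift_forest_surj v isoG; exists F.
Qed.

(** The forests are split by the role of [m]: isolated, leaf child of a white vertex, leaf in a
    nontrivial cycle, or not a leaf. The factor [x] stays on both sides, since it may be a zero
    divisor in [R]. *)
Lemma sum_weight_step :
  x * \sum_(G : code | valid_forest G) weight G =
  x * \sum_(F : forest_code n | valid_forest F)
    (x * weight F + weight F *+ n + (y + t) * (weight F *+ n + weight F *+ imp F)).
Proof.
have -> : \sum_(G : code | valid_forest G) weight G =
    \sum_(G : code | isolated G) weight G
    + \sum_(G : code | [&& valid_forest G, leaf G, G.1 m == m & G.2 m != None])
        weight G
    + \sum_(G : code | [&& valid_forest G, leaf G & G.1 m != m]) weight G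
    + \sum_(G : code | valid_forest G && ~~ leaf G) weight G.
  rewrite (bigID (@leaf n)) /= (bigID (fun G : code => G.1 m == m)) /=.
  rewrite (bigID (fun G : code => G.2 m == None)) /=.
  by congr (_ + _ + _ + _); apply: eq_bigl => G; rewrite /isolated /iso ?andbA.
rewrite !mulrDr sum_insert_child sum_insert_cycle sum_attach.
rewrite (sum_isolated (fun w _ => w)) (sum_isolated (fun w _ => w *+ n)).
rewrite (sum_isolated (fun w _ => (t * w) *+ n)).
rewrite (sum_isolated (fun w k => (y *+ n + (y + t) *+ k) * w)).
have alg (w : R) (k : nat) :
    x * (x * w) + (x * w) *+ n + (t * (x * w)) *+ n
      + (y *+ n + (y + t) *+ k) * (x * w) =
    x * (x * w + w *+ n + (y + t) * (w *+ n + w *+ k)).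
  rewrite -(mulr_natr w n) -(mulr_natr w k) -(mulr_natr (x * w) n).
  rewrite -(mulr_natr (t * _) n) -(mulr_natr y n) -(mulr_natr (y + t) k).
  move: n%:R k%:R => a c; ring.
rewrite !big_distrr -!big_split; apply: eq_bigr => F _; exact: alg.
Qed.

End Step.
End Weight.

(** * From weights to the polynomials [Q] *)

Section Polynomial.
Local Open Scope ring_scope.

Lemma mderivXU (R : comNzRingType) k (i j : 'I_k) :
  ('X_j : {mpoly R[k]})^`M(i) = (j == i)%:R.
Proof.
rewrite mderivX mnm1E; case: eqP => [->|_]; last by rewrite scale0r.
by rewrite scale1r -{1}[U_(i)%MM]addm0 addmC addmK mpolyX0.
Qed.

(** The extra factor [p] avoids the exponent [e - 1]. *)
Lemma mderiv_exp (R : comNzRingType) k (i : 'I_k) (p : {mpoly R[k]}) e :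
  p * (p ^+ e)^`M(i) = p ^+ e * p^`M(i) *+ e.
Proof.
elim: e => [|e IH]; first by rewrite expr0 -mpolyC1 mderivC mulr0 mulr0n.
rewrite exprS mderivM mulrDr IH mulrnAr -mulrA mulrS.
by rewrite [p^`M(i) * _]mulrC.
Qed.

(** A case of the chain rule, by which the derivative in [y] passes through the substitution
    [z = 1]. *)
Lemma mderiv_comp (R : comNzRingType) h k (i : 'I_h) (j : 'I_k)
    (lq : h.-tuple {mpoly R[k]}) :
  (forall a : 'I_h, (lq`_a)^`M(j) = (a == i)%:R) ->
  forall p, (p \mPo lq)^`M(j) = p^`M(i) \mPo lq.
Proof.
move=> lqD.
pose good p := (p \mPo lq)^`M(j) = p^`M(i) \mPo lq.
have good1 : good 1 by rewrite /good -mpolyC1 comp_mpolyC !mderivC comp_mpoly0.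
have goodM p q : good p -> good q -> good (p * q).
  by rewrite /good => gp gq; rewrite rmorphM !mderivM gp gq raddfD /= !rmorphM.
have goodX m : good 'X_[m].
  rewrite mpolyXE_id; apply: (big_ind good) => // a _.
  elim: (m a) => [|e IH]; rewrite ?expr0 // exprS; apply: goodM => //.
  rewrite /good comp_mpolyXU lqD mderivXU.
  by case: eqP => _; rewrite ?comp_mpoly1 ?comp_mpoly0.
move=> p; rewrite -/(good p); elim/mpolyind: p => [|c m p _ _ gp].
  by rewrite /good comp_mpoly0 !mderiv0 comp_mpoly0.
by rewrite /good comp_mpolyD !mderivD comp_mpolyD !comp_mpolyZ !mderivZ
           comp_mpolyZ goodX gp.
Qed.

Local Notation x := ('X_w0 : {mpoly int[3]}).
Local Notation y := ('X_w1 : {mpoly int[3]}).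
Local Notation t := ('X_w2 : {mpoly int[3]}).

Definition weight_gf n : {mpoly int[3]} :=
  \sum_(F : forest_code n | valid_forest F) weight x y t F.

(** The Euler operator of [y] multiplies a monomial by its degree in [y]; thus the derivative in the
    recurrence counts the marked improper edges. *)
Lemma mderiv_weight n (F : forest_code n) :
  y * (weight x y t F)^`M(w1) = weight x y t F *+ imp F.
Proof.
have D0 (a : 'I_3) e : a != w1 -> ('X_a ^+ e : {mpoly int[3]})^`M(w1) = 0.
  move=> /negPf aw; elim: e => [|e IH]; first by rewrite expr0 -mpolyC1 mderivC.
  by rewrite exprS mderivM IH mderivXU aw mul0r mulr0 addr0.
rewrite /weight !mderivM (D0 w0) ?(D0 w2) ?mul0r ?mulr0 ?addr0 ?add0r;
  try by rewrite -val_eqE /= !inordK.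
have E := mderiv_exp w1 y (imp F); rewrite mderivXU eqxx mulr1 in E.
by rewrite mulrA mulrCA E mulrnAr mulrnAl.
Qed.

(** The recurrence starts at the empty forest; its first step gives [x], in accordance with
    [Q 1 = 1]. *)
Lemma weight_gf0 : weight_gf 0 = 1.
Proof.
have eq0 (F F' : forest_code 0) : F = F'.
  case: F F' => s p [s' p']; congr (_, _); first by apply/permP => -[].
  by apply/ffunP => -[].
pose F0 : forest_code 0 := (1%g, [ffun=> None]).
have v0 : valid_forest F0.
  by apply/valid_forestP; split=> [[]//|]; exists (fun=> 0%N) => -[].
rewrite /weight_gf (big_pred1 F0) => [|F]; last first.
  by rewrite (eq0 F F0) v0 /= eqxx.
have [b [l H]] := valid_wf v0.
by rewrite (weight_omega _ _ _ H) big_ord0.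
Qed.

Lemma weight_gf_step n : weight_gf n.+1 =
  x * weight_gf n + weight_gf n *+ n + (y + t) * (weight_gf n *+ n + y * (weight_gf n)^`M(w1)).
Proof.
have x0 : x != 0 by rewrite -msize_poly_eq0 msizeX.
apply: (mulfI x0); rewrite /weight_gf sum_weight_step; congr (_ * _).
rewrite !big_split /= -!big_distrr /= !big_split /=; congr (_ + _ + _ * (_ + _)).
- by rewrite -sumrMnl.
- by rewrite -sumrMnl.
- rewrite raddf_sum big_distrr; apply: eq_bigr => F _.
  by rewrite -mderiv_weight.
Qed.

Lemma weight_gf_forest_gf n : (0 < n)%N -> weight_gf n = x * forest_gf n.
Proof.
move=> n0; rewrite /forest_gf big_distrr; apply: eq_bigr => F /valid_wf[b [l H]].
by rewrite /weight /= !mulrA -exprS prednK // (wf_ntree_gt0 H n0).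
Qed.

Lemma weight_gf_Qz1 n : (0 < n)%N -> weight_gf n = x * Qz1 n.
Proof.
case: n => // n _; elim: n => [|n IH].
  rewrite weight_gf_step weight_gf0 -mpolyC1 mderivC !mulr0n mulr0 !addr0 mulr0 addr0.
  by rewrite /Qz1 /Q /= -mpolyC1 comp_mpolyC.
rewrite weight_gf_step IH mderivM mderivXU.
(* The surplus factor [x] does not involve [y] and leaves the derivative. *)
have -> : (w0 == w1) = false by rewrite -val_eqE /= !inordK.
rewrite mul0r add0r /Qz1.
have -> : Q n.+2 = Qop n.+1 (Q n.+1) by [].
set P := Q n.+1; rewrite /Qop.
set lq := [tuple 'X_w0; 'X_w1; 1; 'X_w2].
have vE (i : 'I_4) : lq`_i = nth 0 [:: x; y; 1; t] i by [].
have DP : (P \mPo lq)^`M(w1) = P^`M(vy) \mPo lq.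
  apply: mderiv_comp => a; rewrite vE -!val_eqE /= inordK //.
  case: a => -[|[|[|[|//]]]] /= _; rewrite ?mderivXU -?val_eqE /= ?inordK //.
  by rewrite -mpolyC1 mderivC.
have cM p q : (p * q) \mPo lq = (p \mPo lq) * (q \mPo lq) by rewrite rmorphM.
have cn : n.+1%:R \mPo lq = n.+1%:R by rewrite comp_mpolyMn comp_mpoly1.
rewrite DP !(comp_mpolyD, cM, cn) !comp_mpolyXU !vE !inordK //=.
rewrite -(mulr_natr (x * _) n.+1).
move: n.+1%:R => c; ring.
Qed.
End Polynomial.

Theorem theorem3p3 (n : nat) : (1 <= n)%N -> Qz1 n = forest_gf n.
Proof.
move=> n0; have x0 : ('X_w0 : {mpoly int[3]})%R != 0%R by rewrite -msize_poly_eq0 msizeX.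
by apply: (mulfI x0); rewrite -weight_gf_forest_gf // -weight_gf_Qz1.
Qed.
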